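(* With probability one there exists $n_0$ such that for every $n\ge n_0$ the function $\mathbb R^3\ni(\alpha',\theta_1',\theta_2')\mapsto Q_n(\mathbf Y_n;\alpha',\theta_1',\theta_2')$ has a unique global minimizer, denoted $(\tilde\alpha_n,\tilde\theta_{1,n},\tilde\theta_{2,n})$. Moreover, for every $(\alpha,\theta_1,\theta_2)\in(0,1)\times\mathbb N^2$, almost surely $\tilde\alpha_n\to\alpha$ and, for $i=1,2$, $$\tilde\theta_{i,n}\to Y_{s_i}-\frac{\alpha}{1+\alpha^2}(Y_{s_i-1}+Y_{s_i+1})-\frac{1-\alpha}{1+\alpha^2}\mu_\varepsilon\qquad(n\to\infty).$$
   Context: INAR(1) process: Let $\alpha\in(0,1)$. Let $(\varepsilon_k)_{k\in\mathbb N}$ be i.i.d. non-negative integer-valued random variables with $\mathbb E\varepsilon_1^2<\infty$ and $\mathbb P(\varepsilon_1\ne 0)>0$; write $\mu_\varepsilon=\mathbb E\varepsilon_1$ (assumed known). For each $k\in\mathbb N$ let $(\xi_{k,j})_{j\in\mathbb N}$ be i.i.d. Bernoulli random variables with mean $\alpha$, these sequences being mutually independent and independent of $(\varepsilon_k)$. Let $X_0$ be a non-negative integer-valued random variable with $\mathbb E X_0^2<\infty$, independent of all $\xi_{k,j}$ and $\varepsilon_k$, and set $X_k=\sum_{j=1}^{X_{k-1}}\xi_{k,j}+\varepsilon_k$ for $k\in\mathbb N$. Two non-neighbouring additive outliers: fix known times $s_1,s_2\in\mathbb N$ with $s_1<s_2-1$ and sizes $\theta_1,\theta_2\in\mathbb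 N$; let $Y_k=X_k+\delta_{k,s_1}\theta_1+\delta_{k,s_2}\theta_2$, $k\in\mathbb Z_+$; $\mathbf Y_n=(Y_0,\dots,Y_n)$. For $n\ge s_2+1$, $$Q_n(\mathbf y_n;\alpha',\theta_1',\theta_2')=\sum_{\substack{k=1\\k\notin\{s_1,s_1+1,s_2,s_2+1\}}}^n(y_k-\alpha'y_{k-1}-\mu_\varepsilon)^2+\sum_{i=1}^2\Big[(y_{s_i}-\alpha'y_{s_i-1}-\mu_\varepsilon-\theta_i')^2+(y_{s_i+1}-\alpha'y_{s_i}-\mu_\varepsilon+\alpha'\theta_i')^2\Big].$$ *)

(* Defs.v *)
From HB Require Import structures.
From mathcomp Require Import all_boot all_order all_algebra.
From mathcomp Require Import all_classical all_reals all_analysis.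
Set Implicit Arguments. Unset Strict Implicit. Unset Printing Implicit Defensive.
Import Order.TTheory GRing.Theory Num.Theory.
Import numFieldNormedType.Exports.
Local Open Scope classical_set_scope.
Local Open Scope ring_scope.

(* Index type for the driving family of the INAR(1) process:
   None             ~ X_0
   Some (inl k)     ~ eps_{k+1}
   Some (inr (k,j)) ~ xi_{k+1, j+1}                                        *)
Definition inar_idx := option (nat + (nat * nat)).

Definition inar_family {T : Type} (X0 : T -> nat) (eps : nat -> T -> nat)
  (xi : nat -> nat -> T -> nat) : inar_idx -> T -> nat :=
  fun i => match i with
           | None => X0
           | Some (inl k) => eps k
           | Some (inr (k, j)) => xi k j
           end.

Definition nat_rvs {d} {T : measurableType d} {I : Type} (Z : I -> T -> nat) : Prop :=
  forall i (B : set nat), measurable (Z i @^-1` B).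

Definition mutually_independent {d} {T : measurableType d} {R : realType}
  {I : eqType} (P : probability T R) (Z : I -> T -> nat) : Prop :=
  forall (s : seq I) (B : I -> set nat), uniq s ->
    P (\bigcap_(i in [set` s]) (Z i @^-1` B i)) = (\prod_(i <- s) P (Z i @^-1` B i))%E.

Fixpoint inarX {T : Type} (X0 : T -> nat) (eps : nat -> T -> nat)
  (xi : nat -> nat -> T -> nat) (k : nat) (t : T) : nat :=
  match k with
  | 0 => X0 t
  | k'.+1 => (\sum_(0 <= j < inarX X0 eps xi k' t) xi k' j t + eps k' t)%N
  end.

Definition inarY {R : realType} {T : Type} (X0 : T -> nat) (eps : nat -> T -> nat)
  (xi : nat -> nat -> T -> nat) (s1 s2 th1 th2 : nat) (t : T) (k : nat) : R :=
  (inarX X0 eps xi k t)%:R + (if k == s1 then th1%:R else 0)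
  + (if k == s2 then th2%:R else 0).

Definition Qn {R : realType} (mu : R) (s1 s2 n : nat) (y : nat -> R) (a t1 t2 : R) : R :=
  \sum_(1 <= k < n.+1 | k \notin [:: s1; s1.+1; s2; s2.+1]) (y k - a * y k.-1 - mu) ^+ 2
  + ((y s1 - a * y s1.-1 - mu - t1) ^+ 2 + (y s1.+1 - a * y s1 - mu + a * t1) ^+ 2)
  + ((y s2 - a * y s2.-1 - mu - t2) ^+ 2 + (y s2.+1 - a * y s2 - mu + a * t2) ^+ 2).

Definition is_argmin3 {R : realType} (f : R -> R -> R -> R) (a b c : R) : Prop :=
  forall a' b' c', f a b c <= f a' b' c'.

Definition unique_argmin3 {R : realType} (f : R -> R -> R -> R) : Prop :=
  exists a b c, is_argmin3 f a b c /\
    forall a' b' c', is_argmin3 f a' b' c' -> (a', b', c') = (a, b, c).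

(* Main.v *)
Require Import Defs.
From HB Require Import structures.
From mathcomp Require Import all_boot all_order all_algebra.
From mathcomp Require Import all_classical all_reals all_analysis.
From mathcomp Require Import measurable_realfun.
From mathcomp Require Import ring lra zify.
Import Order.TTheory GRing.Theory Num.Theory.
Import numFieldNormedType.Exports.
Local Open Scope classical_set_scope.
Local Open Scope ring_scope.

Set Implicit Arguments. Unset Strict Implicit. Unset Printing Implicit Defensive.

(* Minimizing [Qn] over the outlier sizes leaves [A_n a^2 - 2 B_n a + C_n + h(a)],
   where [A_n], [B_n] are the sums of [y_(k-1)^2] and [(y_k - mu) y_(k-1)] over the
   regular times and [h >= 0] is a fixed rational function whose second differences
   are bounded below.  If [A_n -> +oo], this is eventually strictly convex, and
   comparing a minimizer with [alpha] gives
   [(a_n - B_n / A_n)^2 <= (alpha - B_n / A_n)^2 + h(alpha) / A_n];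
   so it suffices that [A_n -> +oo] and [B_n / A_n -> alpha] almost surely.
   The first holds because [X_k >= eps_k] is nonzero infinitely often.  For the second,
   let [M_k = X_(k+1) - alpha X_k - mu] and [b_k = 1 + X_0^2 + ... + X_(k-1)^2]; by
   Kronecker's lemma it suffices that [\sum_k X_k M_k / b_(k+1)] converges.
   Only second moments are available, but self-normalization compensates: since
   [X_k <= sqrt b_(k+1)] and [E (M_k^2 | past) <= K (1 + X_k)], the conditional
   variance of the [k]-th term is at most [4 K (1 / sqrt b_k - 1 / sqrt b_(k+1))],
   which telescopes, and stopping yields the maximal inequality. *)

(** * The least squares problem *)

Lemma inv1sqr_lipschitz {R : realFieldType} (x y : R) :
  `|(1 + x ^+ 2)^-1 - (1 + y ^+ 2)^-1| <= `|x - y|.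
Proof.
have x0 : 0 < 1 + x ^+ 2 by rewrite ltr_pwDl ?sqr_ge0.
have y0 : 0 < 1 + y ^+ 2 by rewrite ltr_pwDl ?sqr_ge0.
have -> : (1 + x ^+ 2)^-1 - (1 + y ^+ 2)^-1
    = (x - y) * (- (x + y) / ((1 + x ^+ 2) * (1 + y ^+ 2))).
  by field; rewrite !gt_eqF.
rewrite normrM ler_piMr// normrM normrN normfV ler_pdivrMr ?normr_gt0 ?mul1r.
  rewrite (gtr0_norm (mulr_gt0 x0 y0)) ler_norml.
  have := mulr_ge0 (sqr_ge0 x) (sqr_ge0 y).
  (* The squares around [2^-1] and [- 2^-1] give [|x + y| <= x^2 + y^2 + 1/2], which is below the
     product of the denominators. *)
  have := sqr_ge0 (x + 2^-1); have := sqr_ge0 (y + 2^-1).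
  have := sqr_ge0 (x - 2^-1); have := sqr_ge0 (y - 2^-1).
  by move=> ? ? ? ? ?; apply/andP; split; lra.
by rewrite mulf_neq0// gt_eqF.
Qed.

Lemma div1sqr_lipschitz {R : realFieldType} (x y : R) :
  `|x / (1 + x ^+ 2) - y / (1 + y ^+ 2)| <= `|x - y|.
Proof.
have x0 : 0 < 1 + x ^+ 2 by rewrite ltr_pwDl ?sqr_ge0.
have y0 : 0 < 1 + y ^+ 2 by rewrite ltr_pwDl ?sqr_ge0.
have -> : x / (1 + x ^+ 2) - y / (1 + y ^+ 2)
    = (x - y) * ((1 - x * y) / ((1 + x ^+ 2) * (1 + y ^+ 2))).
  by field; rewrite !gt_eqF.
rewrite normrM ler_piMr// normrM normfV ler_pdivrMr ?normr_gt0 ?mul1r.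
  rewrite (gtr0_norm (mulr_gt0 x0 y0)) ler_norml.
  have xy := mulr_ge0 (sqr_ge0 x) (sqr_ge0 y).
  have := sqr_ge0 (x - y); have := sqr_ge0 (x + y).
  have := sqr_ge0 x; have := sqr_ge0 y.
  by move=> ? ? ? ?; apply/andP; split; lra.
by rewrite mulf_neq0// gt_eqF.
Qed.

(** The second difference is [d] times a combination of the first differences of [1 / (1 + z^2)] and
    [z / (1 + z^2)] between [m - d] and [m + d]. These are at most [2 |d|] by the Lipschitz bounds,
    and the coefficients are at most 1 in absolute value. *)
Lemma inv1sqr_second_diff {R : realFieldType} (m d : R) :
  `|(1 + (m + d) ^+ 2)^-1 + (1 + (m - d) ^+ 2)^-1 - 2 * (1 + m ^+ 2)^-1|
  <= 4 * d ^+ 2.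
Proof.
have pos z : 0 < 1 + z ^+ 2 :> R by rewrite ltr_pwDl ?sqr_ge0.
have x0 := pos (m + d); have y0 := pos (m - d); have m0 := pos m.
have := div1sqr_lipschitz (m - d) (m + d).
have := inv1sqr_lipschitz (m - d) (m + d).
have -> : m - d - (m + d) = - (2 * d) by ring.
rewrite normrN normrM ger0_norm//.
set p := (X in `|X| <= _) => lp; set q := (X in `|X| <= _ -> _) => lq.
have -> : (1 + (m + d) ^+ 2)^-1 + (1 + (m - d) ^+ 2)^-1 - 2 * (1 + m ^+ 2)^-1
   = d * (q * (1 + m ^+ 2)^-1 + p * (m / (1 + m ^+ 2))).
  by rewrite /p /q; field; rewrite !gt_eqF.
rewrite normrM -[d ^+ 2]real_normK ?num_real//.
have m1 : `|(1 + m ^+ 2)^-1| <= 1.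
  by rewrite normfV invf_le1 ?normr_gt0 ?gt_eqF// gtr0_norm// lerDl sqr_ge0.
have m2 : `|m / (1 + m ^+ 2)| <= 1.
  rewrite normrM normfV ler_pdivrMr ?normr_gt0 ?gt_eqF// mul1r (gtr0_norm m0).
  have := sqr_ge0 (m + 2^-1); have := sqr_ge0 (m - 2^-1).
  by rewrite ler_norml => ? ?; apply/andP; split; lra.
have : `|q * (1 + m ^+ 2)^-1 + p * (m / (1 + m ^+ 2))| <= 4 * `|d|.
  rewrite (le_trans (ler_normD _ _))// !normrM.
  have -> : 4 * `|d| = 2 * `|d| * 1 + 2 * `|d| * 1 by ring.
  by rewrite -[`|m| * _]normrM lerD// ler_pM.
by have := normr_ge0 d; nra.
Qed.

Lemma div1sqr_second_diff {R : realFieldType} (m d : R) :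
  `|(m + d) / (1 + (m + d) ^+ 2) + (m - d) / (1 + (m - d) ^+ 2)
    - 2 * (m / (1 + m ^+ 2))| <= 4 * d ^+ 2.
Proof.
have pos z : 0 < 1 + z ^+ 2 :> R by rewrite ltr_pwDl ?sqr_ge0.
have x0 := pos (m + d); have y0 := pos (m - d); have m0 := pos m.
have := div1sqr_lipschitz (m - d) (m + d).
have := inv1sqr_lipschitz (m - d) (m + d).
have -> : m - d - (m + d) = - (2 * d) by ring.
rewrite normrN normrM ger0_norm//.
set p := (X in `|X| <= _) => lp; set q := (X in `|X| <= _ -> _) => lq.
have -> : (m + d) / (1 + (m + d) ^+ 2) + (m - d) / (1 + (m - d) ^+ 2)
    - 2 * (m / (1 + m ^+ 2))
   = d * (q * (m / (1 + m ^+ 2)) - p * (1 + m ^+ 2)^-1).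
  by rewrite /p /q; field; rewrite !gt_eqF.
rewrite normrM -[d ^+ 2]real_normK ?num_real//.
have m1 : `|(1 + m ^+ 2)^-1| <= 1.
  by rewrite normfV invf_le1 ?normr_gt0 ?gt_eqF// gtr0_norm// lerDl sqr_ge0.
have m2 : `|m / (1 + m ^+ 2)| <= 1.
  rewrite normrM normfV ler_pdivrMr ?normr_gt0 ?gt_eqF// mul1r (gtr0_norm m0).
  have := sqr_ge0 (m + 2^-1); have := sqr_ge0 (m - 2^-1).
  by rewrite ler_norml => ? ?; apply/andP; split; lra.
have : `|q * (m / (1 + m ^+ 2)) - p * (1 + m ^+ 2)^-1| <= 4 * `|d|.
  rewrite (le_trans (ler_normB _ _))// !normrM.
  have -> : 4 * `|d| = 2 * `|d| * 1 + 2 * `|d| * 1 by ring.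
  by rewrite -[`|m| * _]normrM lerD// ler_pM.
by have := normr_ge0 d; nra.
Qed.

(* Minimizing over [t] the two terms of [Qn] that involve an outlier of size
   [t] leaves [(v + a u)^2 / (1 + a^2)], attained at [(u - a v) / (1 + a^2)]. *)
Lemma complete_square {R : realFieldType} (u v a t : R) :
  (u - t) ^+ 2 + (v + a * t) ^+ 2
  = (v + a * u) ^+ 2 / (1 + a ^+ 2)
    + (1 + a ^+ 2) * (t - (u - a * v) / (1 + a ^+ 2)) ^+ 2.
Proof. by field; have := sqr_ge0 a; lra. Qed.

(** The form taken by [(v + a u)^2 / (1 + a^2)] when [u] and [v] are affine in [a]. *)
Definition quartic_ratio {R : fieldType} (c0 c1 c2 a : R) : R :=
  (c0 + c1 * a + c2 * a ^+ 2) ^+ 2 / (1 + a ^+ 2).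

Lemma quartic_ratio_ge0 {R : realFieldType} (c0 c1 c2 a : R) :
  0 <= quartic_ratio c0 c1 c2 a.
Proof. by rewrite divr_ge0 ?sqr_ge0// addr_ge0 ?sqr_ge0. Qed.

(** Division by [1 + a^2] leaves a quadratic with leading coefficient [c2^2 >= 0], plus
    [S / (1 + a^2)] and [U a / (1 + a^2)]. Only the last two can have negative second differences,
    and these were bounded above. *)
Lemma quartic_ratio_second_diff {R : realFieldType} (c0 c1 c2 : R) :
  exists2 K : R, 0 <= K & forall x y,
    - K * (x - y) ^+ 2 <= quartic_ratio c0 c1 c2 x + quartic_ratio c0 c1 c2 y
       - 2 * quartic_ratio c0 c1 c2 ((x + y) / 2).
Proof.
pose S := (c0 - c2) ^+ 2 - c1 ^+ 2; pose U := 2 * c1 * (c0 - c2).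
exists (`|S| + `|U|) => [|x y]; first by rewrite addr_ge0.
have [m [d [-> ->]]] : exists m d, x = m + d /\ y = m - d.
  by exists ((x + y) / 2), ((x - y) / 2); split; field.
have -> : (m + d + (m - d)) / 2 = m by field.
have -> : (m + d - (m - d)) = 2 * d by ring.
have qE a : quartic_ratio c0 c1 c2 a = c2 ^+ 2 * a ^+ 2 + 2 * c1 * c2 * a
    + (c1 ^+ 2 + 2 * c0 * c2 - c2 ^+ 2) + S * (1 + a ^+ 2)^-1
    + U * (a / (1 + a ^+ 2)).
  by rewrite /quartic_ratio /S /U; field; have := sqr_ge0 a; lra.
rewrite !qE.
have := inv1sqr_second_diff m d; have := div1sqr_second_diff m d.
set p := (X in `|X| <= _) => lp; set q := (X in `|X| <= _ -> _) => lq.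
have Sq : `|S * q| <= `|S| * (4 * d ^+ 2) by rewrite normrM ler_wpM2l.
have Up : `|U * p| <= `|U| * (4 * d ^+ 2) by rewrite normrM ler_wpM2l.
move: Sq Up; rewrite !ler_norml => /andP[Sq _] /andP[Up _].
rewrite [leRHS](_ : _ = 2 * c2 ^+ 2 * d ^+ 2 + S * q + U * p); last first.
  by rewrite /p /q; ring.
have := mulr_ge0 (sqr_ge0 c2) (sqr_ge0 d); lra.
Qed.

Lemma continuous_quartic_ratio {R : realType} (c0 c1 c2 : R) :
  continuous (quartic_ratio c0 c1 c2).
Proof.
move=> a; rewrite /quartic_ratio.
have sqr_cvg (f : R -> R) (l : R) : f b @[b --> a] --> l ->
    f b ^+ 2 @[b --> a] --> l ^+ 2.
  by move=> fl; rewrite expr2; under eq_fun do rewrite expr2; exact: cvgM.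
have ca : b @[b --> a] --> a by exact: cvg_id.
apply: cvgM.
  apply: (sqr_cvg _ _); apply: cvgD; [apply: cvgD; [exact: cvg_cst|]|].
    by apply: cvgM => //; exact: cvg_cst.
  by apply: cvgM; [exact: cvg_cst|exact: sqr_cvg].
apply: cvgV; first by have := sqr_ge0 a; lra.
by apply: cvgD; [exact: cvg_cst|exact: sqr_cvg].
Qed.

(** Existence is by compactness, since [g] exceeds [g 0] outside [[-M, M]]. For uniqueness,
    comparing two minimizers with their midpoint gives [(A / 2 - K) (a' - c)^2 <= 0]. *)
Lemma unique_argmin_quad {R : realType} (h : R -> R) (K A B C : R) :
  continuous h -> (forall x, 0 <= h x) -> 0 <= K ->
  (forall x y, - K * (x - y) ^+ 2 <= h x + h y - 2 * h ((x + y) / 2)) ->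
  2 * K < A ->
  let g a := A * a ^+ 2 - 2 * B * a + C + h a in
  exists a, (forall b, g a <= g b)
            /\ forall a', (forall b, g a' <= g b) -> a' = a.
Proof.
move=> ch h0 K0 hK KA g.
have A0 : 0 < A by lra.
(* Chosen so that [|b| > M] forces [|b| (A |b| - 2 |B|) >= |g 0 - C|], hence [g b >= g 0] because
   [h >= 0]. *)
pose M := (2 * `|B| + `|g 0 - C| + 1) / A + 1.
have M1 : 1 <= M.
  rewrite lerDr divr_ge0 ?(ltW A0)// !addr_ge0// mulr_ge0//.
have AM : 2 * `|B| + `|g 0 - C| + 1 <= A * M.
  rewrite /M mulrDr mulr1 mulrCA mulfV ?gt_eqF//; lra.
have cg : continuous g.
  move=> a; apply: cvgD; last exact: ch.
  apply: cvgD; last exact: cvg_cst.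
  apply: cvgB.
    apply: cvgM; first exact: cvg_cst.
    rewrite expr2; under eq_fun do rewrite expr2.
    by apply: cvgM; exact: cvg_id.
  by apply: cvgM; [exact: cvg_cst|exact: cvg_id].
have [|//|c cM cmin] := @EVT_min R g (- M) M.
- lra.
- exact: continuous_subspaceT.
have gc b : g c <= g b.
  have [bM|] := boolP (b \in `[- M, M]); first exact: cmin.
  rewrite in_itv/= -ler_norml -ltNge => Mb.
  apply: (@le_trans _ _ (g 0)); first by apply: cmin; rewrite in_itv/=; lra.
  have : g 0 - C <= A * b ^+ 2 - 2 * B * b; last by move: (h0 b); rewrite /g; lra.
  apply: (le_trans (ler_norm _)).
  have Bb : B * b <= `|B| * `|b| by rewrite -normrM ler_norm.
  rewrite -[b ^+ 2]real_normK ?num_real//.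
  have N0 := normr_ge0 (g 0 - C); have NB := normr_ge0 B.
  have b1 : 1 <= `|b| by lra.
  have : A * M <= A * `|b| by rewrite ler_pM2l//; lra.
  nra.
exists c; split => // a' amin; apply/eqP; rewrite -subr_eq0 -sqrf_eq0.
have := gc ((a' + c) / 2); have := amin ((a' + c) / 2); have := hK a' c.
rewrite /g => hac h1 h2.
have s0 := sqr_ge0 (a' - c).
have : (A / 2 - K) * (a' - c) ^+ 2 <= 0.
  have -> : (A / 2 - K) * (a' - c) ^+ 2
    = A * (a' ^+ 2 + c ^+ 2 - 2 * ((a' + c) / 2) ^+ 2) + - K * (a' - c) ^+ 2.
    by field.
  lra.
rewrite pmulr_rle0; last lra.
by move=> ?; rewrite eq_le s0 andbT.
Qed.

Definition outlier_estimate {R : fieldType} (mu : R) (y : nat -> R) (s : nat) (a : R) : R :=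
  y s - a / (1 + a ^+ 2) * (y s.-1 + y s.+1) - (1 - a) / (1 + a ^+ 2) * mu.

Lemma cvg_outlier_estimate {R : realType} (mu : R) (y : nat -> R) (s : nat)
    (a : nat -> R) (l : R) :
  a n @[n --> \oo] --> l ->
  outlier_estimate mu y s (a n) @[n --> \oo] --> outlier_estimate mu y s l.
Proof.
move=> al; rewrite /outlier_estimate.
have cinv : (1 + a n ^+ 2)^-1 @[n --> \oo] --> (1 + l ^+ 2)^-1.
  apply: cvgV; first by have := sqr_ge0 l; lra.
  apply: cvgD; first exact: cvg_cst.
  by rewrite expr2; under eq_fun do rewrite expr2; exact: cvgM.
apply: cvgB; first apply: cvgB.
- exact: cvg_cst.
- by apply: cvgM; [exact: cvgM|exact: cvg_cst].
- apply: cvgM; [apply: cvgM => //|exact: cvg_cst].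
  by apply: cvgB => //; exact: cvg_cst.
Qed.

(** Here [u = y_s - a y_(s-1) - mu] and [v = y_(s+1) - a y_s - mu]; the contaminated value [y_s]
    cancels in [v + a u]. *)
Definition outlier_loss {R : fieldType} (mu : R) (y : nat -> R) (s : nat) (a : R) : R :=
  quartic_ratio (y s.+1 - mu) (- mu) (- y s.-1) a.

Lemma outlier_termsE {R : realFieldType} (mu : R) (y : nat -> R) (s : nat) (a t : R) :
  (y s - a * y s.-1 - mu - t) ^+ 2 + (y s.+1 - a * y s - mu + a * t) ^+ 2
  = outlier_loss mu y s a + (1 + a ^+ 2) * (t - outlier_estimate mu y s a) ^+ 2.
Proof.
have a0 : 1 + a ^+ 2 != 0 by have := sqr_ge0 a; lra.
rewrite complete_square /outlier_loss /quartic_ratio /outlier_estimate.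
congr (_ / _ + _ * (_ - _) ^+ 2); first by ring.
by field.
Qed.

(** * Profiling out the outlier sizes *)

Section least_squares.
Context {R : realType} (mu : R) (s1 s2 : nat) (y : nat -> R).

Definition regular_times : pred nat :=
  fun k => k \notin [:: s1; s1.+1; s2; s2.+1].
Definition sumYY n : R := \sum_(1 <= k < n.+1 | regular_times k) y k.-1 ^+ 2.
Definition sumYY1 n : R :=
  \sum_(1 <= k < n.+1 | regular_times k) (y k - mu) * y k.-1.
Definition profile n (a : R) : R :=
  sumYY n * a ^+ 2 - 2 * sumYY1 n * a
  + \sum_(1 <= k < n.+1 | regular_times k) (y k - mu) ^+ 2
  + (outlier_loss mu y s1 a + outlier_loss mu y s2 a).

Lemma QnE n a t1 t2 :
  Qn mu s1 s2 n y a t1 t2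
  = profile n a + (1 + a ^+ 2) * (t1 - outlier_estimate mu y s1 a) ^+ 2
                + (1 + a ^+ 2) * (t2 - outlier_estimate mu y s2 a) ^+ 2.
Proof.
rewrite /Qn !outlier_termsE /profile /sumYY /sumYY1.
rewrite (_ : \sum_(1 <= k < n.+1 | _) (y k - a * y k.-1 - mu) ^+ 2
  = \sum_(1 <= k < n.+1 | regular_times k) y k.-1 ^+ 2 * a ^+ 2
    - 2 * \sum_(1 <= k < n.+1 | regular_times k) (y k - mu) * y k.-1 * a
    + \sum_(1 <= k < n.+1 | regular_times k) (y k - mu) ^+ 2); last first.
  rewrite mulr_sumr -sumrB -big_split/=; apply: eq_bigr => k _; ring.
rewrite -mulr_suml -[X in _ - 2 * X + _]mulr_suml; ring.
Qed.

(** In [QnE] each square has a positive coefficient and vanishes at exactly one size, so the sizes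
    are functions of the first coordinate. *)
Lemma is_argmin3_Qn n a b c :
  is_argmin3 (Qn mu s1 s2 n y) a b c <->
  (forall a', profile n a <= profile n a')
  /\ b = outlier_estimate mu y s1 a /\ c = outlier_estimate mu y s2 a.
Proof.
have pos (z w : R) : 0 <= (1 + z ^+ 2) * w ^+ 2.
  by rewrite mulr_ge0 ?sqr_ge0// addr_ge0 ?sqr_ge0.
split=> [amin|[amin [-> ->]] a' b' c'].
- have le a' := amin a' (outlier_estimate mu y s1 a') (outlier_estimate mu y s2 a').
  move: le; setoid_rewrite QnE; setoid_rewrite subrr.
  setoid_rewrite expr0n; setoid_rewrite mulr0; setoid_rewrite addr0 => /= le.
  have p1 := pos a (b - outlier_estimate mu y s1 a).
  have p2 := pos a (c - outlier_estimate mu y s2 a).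
  split => [a'|]; first by have := le a'; lra.
  have z w : (1 + a ^+ 2) * w ^+ 2 <= 0 -> w = 0.
    rewrite pmulr_rle0 ?ltr_pwDl ?sqr_ge0// => w0.
    by apply/eqP; rewrite -sqrf_eq0 eq_le w0 sqr_ge0.
  by split; apply/eqP; rewrite -subr_eq0; apply/eqP; apply: z; have := le a; lra.
- rewrite !QnE !subrr expr0n/= mulr0 !addr0.
  have := amin a'; have := pos a' (b' - outlier_estimate mu y s1 a').
  by have := pos a' (c' - outlier_estimate mu y s2 a'); lra.
Qed.

Lemma outlier_loss_sum :
  exists2 K : R, 0 <= K & forall a b,
    - K * (a - b) ^+ 2 <=
    (outlier_loss mu y s1 a + outlier_loss mu y s2 a)
    + (outlier_loss mu y s1 b + outlier_loss mu y s2 b)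
    - 2 * (outlier_loss mu y s1 ((a + b) / 2) + outlier_loss mu y s2 ((a + b) / 2)).
Proof.
have [K1 K10 h1] := quartic_ratio_second_diff (y s1.+1 - mu) (- mu) (- y s1.-1).
have [K2 K20 h2] := quartic_ratio_second_diff (y s2.+1 - mu) (- mu) (- y s2.-1).
exists (K1 + K2) => [|a b]; first exact: addr_ge0.
by have := h1 a b; have := h2 a b; rewrite /outlier_loss; lra.
Qed.

Lemma profile_unique_argmin (K : R) n :
  0 <= K ->
  (forall a b, - K * (a - b) ^+ 2 <=
    (outlier_loss mu y s1 a + outlier_loss mu y s2 a)
    + (outlier_loss mu y s1 b + outlier_loss mu y s2 b)
    - 2 * (outlier_loss mu y s1 ((a + b) / 2)
           + outlier_loss mu y s2 ((a + b) / 2))) ->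
  2 * K < sumYY n -> unique_argmin3 (Qn mu s1 s2 n y).
Proof.
move=> K0 hK KA.
have [|a|a [amin auniq]] := @unique_argmin_quad R
  (fun a => outlier_loss mu y s1 a + outlier_loss mu y s2 a) K (sumYY n)
  (sumYY1 n) (\sum_(1 <= k < n.+1 | regular_times k) (y k - mu) ^+ 2) _ _ K0 hK KA.
- by move=> a; apply: cvgD; exact: continuous_quartic_ratio.
- by rewrite addr_ge0 ?quartic_ratio_ge0.
exists a, (outlier_estimate mu y s1 a), (outlier_estimate mu y s2 a).
split=> [|a' b' c' /is_argmin3_Qn[a'min [-> ->]]].
  exact/is_argmin3_Qn.
by rewrite (auniq a').
Qed.

(** The deterministic half of the theorem: it isolates the two limits that a single path must
    satisfy. *)
Lemma least_squares_consistent (alpha : R) :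
  sumYY n @[n --> \oo] --> +oo ->
  (sumYY1 n / sumYY n) @[n --> \oo] --> alpha ->
  exists n0 : nat, (s2.+1 <= n0)%N /\
    (forall n, (n0 <= n)%N -> unique_argmin3 (Qn mu s1 s2 n y)) /\
    (forall a b c : nat -> R,
       (forall n, (n0 <= n)%N -> is_argmin3 (Qn mu s1 s2 n y) (a n) (b n) (c n)) ->
       a n @[n --> \oo] --> alpha /\
       b n @[n --> \oo] --> outlier_estimate mu y s1 alpha /\
       c n @[n --> \oo] --> outlier_estimate mu y s2 alpha).
Proof.
move=> Aoo BA.
have [K K0 hK] := outlier_loss_sum.
have [n1 _ An1] := (cvgryPgt _).1 Aoo (2 * K).
(* Past [n1] the leading coefficient exceeds [2 K]; from [s2.+1] on, all outlier terms belong to the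
   observed sample. *)
exists (maxn n1 s2.+1); split; first exact: leq_maxr.
split=> [n|a b c argmin_abc].
  rewrite geq_max => /andP[n1n _].
  exact: profile_unique_argmin hK (An1 _ n1n).
have near_argmin n : (maxn n1 s2.+1 <= n)%N ->
    [/\ 0 < sumYY n, forall a', profile n (a n) <= profile n a',
        b n = outlier_estimate mu y s1 (a n) & c n = outlier_estimate mu y s2 (a n)].
  move=> n0n; have /is_argmin3_Qn[? [? ?]] := argmin_abc _ n0n; split=> //.
  have := An1 n; rewrite /= (leq_trans _ n0n) ?leq_maxl// => /(_ isT); lra.
have acvg : a n @[n --> \oo] --> alpha.
  (* Complete the square in [profile n (a n) <= profile n alpha], drop the nonnegative losses at
     [a n] and divide by [sumYY n]: this gives [bnd n]. *)
  pose h := outlier_loss mu y s1 alpha + outlier_loss mu y s2 alpha.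
  pose bnd n := (alpha - sumYY1 n / sumYY n) ^+ 2 + h / sumYY n.
  have bnd0 : Num.sqrt (bnd n) @[n --> \oo] --> (0 : R).
    rewrite -[X in _ --> X](@sqrtr0 R).
    apply: (@continuous_cvg _ _ _ _ _ _ Num.sqrt); first exact: sqrt_continuous.
    rewrite [X in _ --> X](_ : 0 = (alpha - alpha) ^+ 2 + h * 0 :> R); last first.
      by rewrite subrr expr0n/= mulr0 addr0.
    apply: cvgD.
      rewrite expr2; under eq_fun do rewrite expr2.
      by apply: cvgM; apply: cvgB => //; exact: cvg_cst.
    apply: cvgM; first exact: cvg_cst.
    apply: (gtr0_cvgV0 _).2 => //; near=> n; have [|//] := near_argmin n.
    by near: n; exists (maxn n1 s2.+1).
  have aB0 : a n - sumYY1 n / sumYY n @[n --> \oo] --> (0 : R).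
    apply/norm_cvg0P; apply: (@squeeze_cvgr _ _ _ _ (fun=> 0)); last exact: bnd0.
      near=> n; rewrite normr_ge0/= -sqrtr_sqr ler_wsqrtr//.
      have [] := near_argmin n.
        by near: n; exists (maxn n1 s2.+1).
      move=> A0 /(_ alpha); rewrite /profile => le _ _.
      have l1 : 0 <= outlier_loss mu y s1 (a n) by exact: quartic_ratio_ge0.
      have l2 : 0 <= outlier_loss mu y s2 (a n) by exact: quartic_ratio_ge0.
      rewrite -(ler_pM2l A0) /bnd.
      have sq z : sumYY n * (z - sumYY1 n / sumYY n) ^+ 2 =
          sumYY n * z ^+ 2 - 2 * sumYY1 n * z + sumYY1 n ^+ 2 / sumYY n.
        by field; rewrite gt_eqF.
      rewrite mulrDr (mulrCA _ h) mulfV ?gt_eqF// mulr1 !sq /h.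
      by move: le; lra.
    exact: cvg_cst.
  rewrite -[X in _ --> X]add0r.
  rewrite [a](_ : _ = fun n => a n - sumYY1 n / sumYY n + sumYY1 n / sumYY n).
    exact: cvgD.
  by apply/funext => n; rewrite subrK.
split=> //; split.
  have ce := @cvg_outlier_estimate _ mu y s1 _ _ acvg.
  apply: cvg_trans ce; apply: near_eq_cvg.
  near=> n; have [|_ _ ->] // := near_argmin n.
  by near: n; exists (maxn n1 s2.+1).
have ce := @cvg_outlier_estimate _ mu y s2 _ _ acvg.
  apply: cvg_trans ce; apply: near_eq_cvg.
near=> n; have [|_ _ _ ->] // := near_argmin n.
by near: n; exists (maxn n1 s2.+1).
Unshelve. all: by end_near. Qed.

End least_squares.

(** * Reduction to a martingale *)

(** Kronecker's lemma, with convergence stated as smallness of sums started late, so that no limit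
    has to be named. *)
Lemma kronecker {R : realType} (b D : nat -> R) :
  nondecreasing_seq b -> b n @[n --> \oo] --> +oo ->
  (forall e : R, 0 < e -> exists m, forall n, (m <= n)%N ->
     `|\sum_(m <= k < n) D k| < e) ->
  (\sum_(0 <= k < n) b k.+1 * D k) / b n @[n --> \oo] --> (0 : R).
Proof.
move=> ndb boo cauchy; apply/cvgrPdist_lt => e e0.
have [|m mP] := cauchy (e / 4); first lra.
(* Abel summation: with [X_k] the sum of [D] from [m] to [k - 1], the difference is minus the sum of
   [(b_(k+1) - b_k) X_k], and these weights telescope. *)
have abel n : (m <= n)%N ->
    `|\sum_(m <= k < n) b k.+1 * D k - b n * \sum_(m <= k < n) D k|
    <= (b n - b m) * (e / 4).
  elim: n => [|n IH].
    by rewrite leqn0 => /eqP->; rewrite !big_geq// mulr0 !subrr normr0 mul0r.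
  rewrite leq_eqVlt => /predU1P[<-|mn].
    by rewrite !big_geq// mulr0 !subrr normr0 mul0r.
  rewrite !big_nat_recr//= [X in `|X|](_ : _ =
    (\sum_(m <= k < n) b k.+1 * D k - b n * \sum_(m <= k < n) D k)
    - (b n.+1 - b n) * \sum_(m <= k < n) D k); last by ring.
  rewrite (le_trans (ler_normB _ _))// normrM.
  rewrite [leRHS](_ : _ = (b n - b m) * (e / 4) + (b n.+1 - b n) * (e / 4));
    last by ring.
  have bb : 0 <= b n.+1 - b n by rewrite subr_ge0 ndb.
  by rewrite lerD ?IH// (ger0_norm bb) ler_wpM2l// ltW// mP.
pose S := \sum_(0 <= k < m) b k.+1 * D k.
(* Beyond this threshold [|S| < e / 4 * b n] and [b n - b m <= 2 b n]. The head, the Abel error and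
   the product [b n * X] then cost [e/4], [e/2] and [e/4] times [b n]. *)
have [N _ bN] := (cvgryPgt _).1 boo (4 * `|S| / e + `|b m| + 1).
near=> n.
have mn : (m <= n)%N by near: n; exists m.
have : 4 * `|S| / e + `|b m| + 1 < b n by apply: bN; near: n; exists N.
have S0 : 0 <= 4 * `|S| / e by rewrite divr_ge0 ?mulr_ge0// ltW.
have bm := ler_norm (- b m); rewrite normrN in bm.
have bm0 := normr_ge0 (b m).
move=> bn; have bn0 : 0 < b n by lra.
rewrite sub0r normrN normrM normfV (gtr0_norm bn0) ltr_pdivrMr//.
rewrite (big_cat_nat (leq0n m) mn)/= -/S.
have Se : `|S| < e / 4 * b n.
  have : e / 4 * (4 * `|S| / e) < e / 4 * b n by rewrite ltr_pM2l; lra.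
  by rewrite [ltLHS](_ : _ = `|S|)//; field; lra.
have := abel _ mn; have := mP _ mn; move: Se.
set X := \sum_(m <= k < n) D k; set Y := \sum_(m <= k < n) _ => Se Xe Ye.
have bX : `|b n * X| <= e / 4 * b n.
  by rewrite normrM (gtr0_norm bn0) mulrC ler_pM2r// ltW.
have : `|S + Y| <= `|S| + (`|Y - b n * X| + `|b n * X|).
  rewrite (le_trans (ler_normD _ _))// lerD2l.
  by rewrite -[X in `|X|](subrK (b n * X)) (le_trans (ler_normD _ _)).
have : (b n - b m) * (e / 4) <= 2 * b n * (e / 4) by rewrite ler_wpM2r; lra.
lra.
Unshelve. all: by end_near. Qed.

(** * Sums along a path and along its contaminated version *)

Section trajectory.
Context {R : realType} (alpha mu : R).
Implicit Types x : nat -> nat.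

Definition sqsum x n : R := \sum_(0 <= k < n) (x k)%:R ^+ 2.
(** The one-step prediction error, indexed by the time of the prediction: it is known only at time
    [k.+1]. *)
Definition noise x k : R := (x k.+1)%:R - alpha * (x k)%:R - mu.
(** The denominator already contains [x_k^2], which is what makes the weight self-normalized; the
    added 1 keeps it positive. *)
Definition weight x k : R := (x k)%:R / (1 + sqsum x k.+1).

Lemma sqsumS x n : sqsum x n.+1 = sqsum x n + (x n)%:R ^+ 2.
Proof. by rewrite /sqsum big_nat_recr. Qed.

Lemma sqsum_ge0 x n : 0 <= sqsum x n.
Proof. by rewrite sumr_ge0// => k _; rewrite sqr_ge0. Qed.

Lemma sqsum_nd x : nondecreasing_seq (sqsum x).
Proof. by apply/nondecreasing_seqP => n; rewrite sqsumS lerDl sqr_ge0. Qed.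

(** The entries are integers, so each nonzero one adds at least 1. *)
Lemma sqsum_cvgy x :
  (forall m, exists2 k, (m <= k)%N & x k != 0%N) ->
  sqsum x n @[n --> \oo] --> +oo.
Proof.
move=> xio; apply/cvgryPge => B.
suff [n Bn] : exists n, B <= sqsum x n.
  by exists n => // k /= nk; exact: le_trans Bn (@sqsum_nd x _ _ nk).
have : exists n, (Num.bound `|B|)%:R <= sqsum x n.
  elim: (Num.bound _) => [|p [n pn]]; first by exists 0%N; exact: sqsum_ge0.
  have [k nk xk] := xio n; exists k.+1.
  rewrite sqsumS -natr1 lerD//; first exact: le_trans pn (@sqsum_nd x _ _ nk).
  by rewrite -natrX ler1n expn_gt0 lt0n xk.
move=> [n Bn]; exists n; apply: le_trans Bn.
exact: le_trans (ler_norm _) (ltW (archi_boundP (normr_ge0 _))).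
Qed.

Variables (s1 s2 : nat) (x : nat -> nat) (y : nat -> R).
Hypothesis s12 : (s1.+1 < s2)%N.
Hypothesis yE : forall k, k != s1 -> k != s2 -> y k = (x k)%:R.

(** The excluded times are at most [s2.+1], so once [s2 < n] their total contribution is a
    constant. *)
Lemma sum_regular_times (F : nat -> R) : exists c, forall n, (s2 < n)%N ->
  \sum_(1 <= k < n.+1 | regular_times s1 s2 k) F k
  = \sum_(1 <= k < n.+1) F k - c.
Proof.
exists (\sum_(1 <= k < s2.+2 | ~~ regular_times s1 s2 k) F k) => n s2n.
rewrite [\sum_(1 <= k < n.+1) F k](bigID (regular_times s1 s2))/= -addrA.
rewrite [X in _ + (X - _)](@big_cat_nat _ _ _ s2.+2 1 n.+1)//=.
rewrite [X in _ + (_ + X - _)]big_nat_cond [X in _ + (_ + X - _)]big_pred0.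
  by rewrite addr0 subrr addr0.
move=> k; rewrite /regular_times !inE negbK; lia.
Qed.

(** At a regular time [k], neither [k] nor [k.-1] is an outlier time, so the summands agree with
    those of the clean path. *)
Lemma sumYY_sqsum : exists c, forall n, (s2 < n)%N -> sumYY s1 s2 y n = sqsum x n - c.
Proof.
have [c cE] := sum_regular_times (fun k => (x k.-1)%:R ^+ 2).
exists c => n s2n.
have -> : sqsum x n = \sum_(1 <= k < n.+1) (x k.-1)%:R ^+ 2.
  by rewrite big_add1.
rewrite -cE// /sumYY big_nat_cond [RHS]big_nat_cond.
apply: eq_bigr => k; rewrite /regular_times !inE => kP.
by rewrite yE//; lia.
Qed.

Lemma sumYY1_noise : exists c, forall n, (s2 < n)%N ->
  sumYY1 mu s1 s2 y n
  = alpha * sumYY s1 s2 y n + \sum_(0 <= k < n) (x k)%:R * noise x k - c.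
Proof.
have [c cE] := sum_regular_times (fun k => (x k.-1)%:R * noise x k.-1).
exists c => n s2n.
have -> : \sum_(0 <= k < n) (x k)%:R * noise x k
    = \sum_(1 <= k < n.+1) (x k.-1)%:R * noise x k.-1 by rewrite big_add1.
rewrite -addrA -cE// /sumYY /sumYY1 mulr_sumr -big_split/=.
rewrite big_nat_cond [RHS]big_nat_cond.
apply: eq_bigr => k; rewrite /regular_times !inE => kP.
rewrite (yE (k := k.-1)) ?(yE (k := k)); [|lia..].
by rewrite /noise prednK; [ring|lia].
Qed.

Lemma sumYY_cvgy : sqsum x n @[n --> \oo] --> +oo ->
  sumYY s1 s2 y n @[n --> \oo] --> +oo.
Proof.
move=> Aoo; have [c cE] := sumYY_sqsum.
apply/cvgryPge => B; have [n0 _ Bn0] := (cvgryPge _).1 Aoo (B + c).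
exists (maxn n0 s2.+1) => // n /=; rewrite geq_max => /andP[n0n s2n].
by rewrite cE//; have := Bn0 _ n0n => /=; lra.
Qed.

Lemma sumYY1_sumYY_cvg : sqsum x n @[n --> \oo] --> +oo ->
  (forall e : R, 0 < e -> exists m, forall n, (m <= n)%N ->
     `|\sum_(m <= k < n) weight x k * noise x k| < e) ->
  sumYY1 mu s1 s2 y n / sumYY s1 s2 y n @[n --> \oo] --> alpha.
Proof.
move=> Aoo cauchy.
have boo : 1 + sqsum x n @[n --> \oo] --> +oo.
  apply/cvgryPge => B; have [n0 _ Bn0] := (cvgryPge _).1 Aoo B.
  by exists n0 => // n n0n; have := Bn0 _ n0n => /=; lra.
have b0 n : 0 < 1 + sqsum x n by rewrite ltr_pwDl ?sqsum_ge0.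
have bnd : nondecreasing_seq (fun n => 1 + sqsum x n).
  by move=> m n mn; rewrite lerD2l sqsum_nd.
pose S n := \sum_(0 <= k < n) (x k)%:R * noise x k.
have SE n : S n = \sum_(0 <= k < n) (1 + sqsum x k.+1) * (weight x k * noise x k).
  by apply: eq_bigr => k _; rewrite mulrA (mulrC (1 + _)) divfK ?gt_eqF.
have S0 : S n / (1 + sqsum x n) @[n --> \oo] --> (0 : R).
  by under eq_fun do rewrite SE; exact: kronecker bnd boo cauchy.
have binv : (1 + sqsum x n)^-1 @[n --> \oo] --> (0 : R).
  by apply: (gtr0_cvgV0 _).2 => //; near=> n.
have [c cE] := sumYY_sqsum; have [c' c'E] := sumYY1_noise.
(* This is [alpha + (S n - c') / sumYY n] with numerator and denominator divided by [1 + sqsum x n];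
   [1 + c] appears since [sumYY n = (1 + sqsum x n) - (1 + c)]. *)
have lim : alpha + (S n / (1 + sqsum x n) - c' * (1 + sqsum x n)^-1)
    / (1 - (1 + c) * (1 + sqsum x n)^-1) @[n --> \oo]
    --> alpha + (0 - c' * 0) / (1 - (1 + c) * 0).
  apply: cvgD; first exact: cvg_cst.
  apply: cvgM; first by apply: cvgB => //; apply: cvgM => //; exact: cvg_cst.
  apply: cvgV; first by rewrite mulr0 subr0 oner_neq0.
  by apply: cvgB; [exact: cvg_cst|apply: cvgM => //; exact: cvg_cst].
move: lim; rewrite !mulr0 subr0 mul0r addr0; apply: cvg_trans; apply: near_eq_cvg.
have [n0 _ n0P] := (cvgryPgt _).1 (sumYY_cvgy Aoo) 0.
near=> n.
have s2n : (s2 < n)%N by near: n; exists s2.+1.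
have A0 : 0 < sumYY s1 s2 y n by apply: n0P; near: n; exists n0.
rewrite c'E// -/(S n).
have -> : 1 - (1 + c) / (1 + sqsum x n) = sumYY s1 s2 y n / (1 + sqsum x n).
  by rewrite cE//; field; rewrite gt_eqF.
by field; rewrite !gt_eqF.
Unshelve. all: by end_near. Qed.

End trajectory.

(** * Independence *)

Section independence.
Context {d} {T : measurableType d} {R : realType} (P : probability T R).
Context {I : eqType} (Z : I -> T -> nat).
Hypothesis rvZ : nat_rvs Z.
Hypothesis indepZ : mutually_independent P Z.

(** Membership in the sigma-algebra of finitely many coordinates, encoded as invariance. As the
    coordinates take countably many values, measurability is a consequence. *)
Definition determined_by (s : seq I) (E : set T) : Prop :=
  forall t t', {in s, forall i, Z i t = Z i t'} -> E t -> E t'.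

Lemma determined_by_sub s r E : {subset s <= r} ->
  determined_by s E -> determined_by r E.
Proof. by move=> sr Es t t' tt'; apply: Es => i /sr; exact: tt'. Qed.

Lemma determined_byI s r E F : determined_by s E -> determined_by r F ->
  determined_by (s ++ r) (E `&` F).
Proof.
move=> Es Fr t t' tt' [Et Ft]; split.
- by apply: Es Et => i si; apply: tt'; rewrite mem_cat si.
- by apply: Fr Ft => i ri; apply: tt'; rewrite mem_cat ri orbT.
Qed.

Lemma determined_by_nil E : determined_by [::] E -> E = set0 \/ E = setT.
Proof.
move=> E0; have [[t Et]|nE] := pselect (exists t, E t); [right|left].
  by apply/seteqP; split=> // t' _; exact: E0 Et.
by apply/seteqP; split=> // t Et; apply: nE; exists t.
Qed.

(** The section of [E] at [Z i = v], as an event that no longer looks at coordinate [i]. *)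
Definition slice (s : seq I) (i : I) (E : set T) (v : nat) : set T :=
  [set t | exists t', [/\ E t', Z i t' = v & {in s, forall j, Z j t' = Z j t}]].

Lemma slice_determined s i E v : determined_by s (slice s i E v).
Proof.
move=> t t' tt' [t'' [Et'' Zv ss]]; exists t''; split=> // j js.
by rewrite ss// tt'.
Qed.

Lemma slice_split s i E : determined_by (i :: s) E ->
  E = \bigcup_v (slice s i E v `&` Z i @^-1` [set v]).
Proof.
move=> dE; apply/seteqP; split => [t Et|t [v _ [[t' [Et' Zt' ss]] /= Zt]]].
  by exists (Z i t) => //; split=> //; exists t.
apply: dE Et' => j; rewrite inE => /predU1P[->|/ss//].
by rewrite Zt' Zt.
Qed.

Lemma measurable_determined s E : determined_by s E -> measurable E.
Proof.
elim: s E => [E /determined_by_nil[]-> //|i s IH E dE].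
rewrite (slice_split dE); apply: bigcupT_measurable => v.
by apply: measurableI; [apply: IH; exact: slice_determined|exact: rvZ].
Qed.

Lemma probability_slice s i E G : determined_by (i :: s) E -> measurable G ->
  P (E `&` G) = (\sum_(v <oo | v \in setT)
                  P (slice s i E v `&` Z i @^-1` [set v] `&` G))%E.
Proof.
move=> dE mG; rewrite {1}(slice_split dE) setI_bigcupl measure_bigcup//.
- move=> v _; apply: measurableI => //; apply: measurableI; last exact: rvZ.
  by apply: (@measurable_determined s); exact: slice_determined.
- apply/trivIsetP => v w _ _ /eqP vw; apply/seteqP; split => // t.
  by move=> [[[_ /= tv] _] [[_ /= tw] _]]; apply: vw; rewrite -tv -tw.
Qed.

(** Induction on [s]: slicing along [i] moves that coordinate from the determined event into the
    cylinder, which is why [r] and [B] are general. *)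
Lemma independent_determined_cylinder s r E (B : I -> set nat) :
  uniq (s ++ r) -> determined_by s E ->
  P (E `&` \bigcap_(i in [set` r]) (Z i @^-1` B i))
  = (P E * \prod_(i <- r) P (Z i @^-1` B i))%E.
Proof.
elim: s r E B => [r E B ur /determined_by_nil[]->|i s IH r E B /= /andP[isr usr] dE].
- by rewrite set0I measure0 mul0e.
- by rewrite setTI probability_setT mul1e indepZ.
have ur : uniq r by move: usr; rewrite cat_uniq => /and3P[].
have mr : measurable (\bigcap_(j in [set` r]) (Z j @^-1` B j)).
  by apply: fin_bigcap_measurable => [|j _]; [exact: finite_seq|exact: rvZ].
(* Used with [q = r] and with [q] empty; the two instances turn both sides of the goal into series
   over [v]. *)
have step (q : seq I) v : uniq (i :: s ++ q) ->
    P (slice s i E v `&` Z i @^-1` [set v] `&` \bigcap_(j in [set` q]) (Z j @^-1` B j))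
    = (P (slice s i E v) * P (Z i @^-1` [set v]) * \prod_(j <- q) P (Z j @^-1` B j))%E.
  move=> uq; pose B' j := if j == i then [set v] else B j.
  have iq : i \notin q.
    by move: uq => /= /andP[]; rewrite mem_cat negb_or => /andP[].
  rewrite -setIA (_ : _ `&` \bigcap_(j in _) _ =
      \bigcap_(j in [set` i :: q]) (Z j @^-1` B' j)).
    rewrite IH; last exact: slice_determined.
    - rewrite big_cons {1}/B' eqxx muleA; congr (_ * _)%E.
      rewrite big_seq [RHS]big_seq; apply: eq_bigr => j jq.
      by rewrite /B'; case: eqP jq iq => // -> ->.
    - by move: uq; rewrite -cat1s uniq_catCA.
  apply/seteqP; split => [t [/= Zv Zq] j /=|t /= Zq].
    rewrite inE /B'; case: eqP => [-> //|_ /= jq]; exact: Zq.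
  split; first by have := Zq i; rewrite /B' /= mem_head eqxx; apply.
  move=> j /= jq; have := Zq j; rewrite /B' /= inE jq orbT => /(_ isT).
  by case: eqP jq iq => // -> ->.
have Ppi : (\prod_(j <- r) P (Z j @^-1` B j))%E \is a fin_num.
  by rewrite -indepZ// fin_num_measure.
rewrite (probability_slice dE mr) -[in RHS](setIT E) (probability_slice dE)//.
rewrite muleC -(fineK Ppi) -nneseriesZl//.
apply: eq_eseriesr => v _; rewrite fineK// step//=; last by rewrite isr.
rewrite muleC; congr (_ * _)%E.
have := step [::] v; rewrite /= cats0 big_nil mule1.
rewrite (_ : \bigcap_(j in _) _ = setT); last by apply/seteqP; split=> // t _ j.
move=> -> //; move: isr; rewrite mem_cat negb_or => /andP[-> _] /=.
by move: usr; rewrite cat_uniq => /and3P[].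
Qed.

(** The same slicing on the other side: a coordinate of [F] is handed over to the first event, and
    the single coordinate left is treated as a cylinder. *)
Lemma independent_determined s r E F : uniq (s ++ r) ->
  determined_by s E -> determined_by r F -> P (E `&` F) = (P E * P F)%E.
Proof.
elim: r s E F => [s E F us dE /determined_by_nil[]->|i r IH s E F usr dE dF].
- by rewrite setI0 measure0 mule0.
- by rewrite setIT probability_setT mule1.
have mE := measurable_determined dE.
have dZ v : determined_by [:: i] (Z i @^-1` [set v]).
  by move=> t t' /= tt' <-; rewrite tt' ?mem_head.
have split1 G q : uniq (q ++ i :: r) -> determined_by q G -> P (F `&` G)
   = (\sum_(v <oo | v \in setT)
       P (Z i @^-1` [set v] `&` G) * P (slice r i F v))%E.
  move=> uq dG; rewrite (probability_slice dF (measurable_determined dG)).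
  apply: eq_eseriesr => v _.
  rewrite [X in P X](_ : _ = (G `&` Z i @^-1` [set v]) `&` slice r i F v); last first.
    by rewrite [RHS]setIC (setIC G) setIA.
  rewrite (IH (q ++ [:: i])); [|by rewrite -catA|exact: determined_byI|exact: slice_determined].
  by rewrite (setIC G).
have PE : P E \is a fin_num by rewrite fin_num_measure.
rewrite setIC (split1 _ _ usr dE) -[in RHS](setIT F) (split1 setT [::]) //; last first.
  by move: usr; rewrite cat_uniq => /and3P[].
rewrite -(fineK PE) -nneseriesZl// => [|v _]; last by rewrite mule_ge0.
apply: eq_eseriesr => v _; rewrite fineK// setIT muleA; congr (_ * _)%E.
rewrite setIC.
have := @independent_determined_cylinder s [:: i] E (fun=> [set v]).
rewrite big_seq1 => <- //; last first.
  by move: usr; rewrite -cat1s catA cat_uniq => /and3P[].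
congr (P (_ `&` _)); apply/seteqP; split=> [t /= tv j|t /(_ i)] /=.
  by rewrite inE => /eqP->.
by apply; rewrite mem_head.
Qed.

Lemma independent_disjoint s r E F : {in s, forall i, i \notin r} ->
  determined_by s E -> determined_by r F -> P (E `&` F) = (P E * P F)%E.
Proof.
move=> sr dE dF; apply: (@independent_determined (undup s) (undup r)).
- rewrite cat_uniq !undup_uniq andbT/=; apply/hasPn => i; rewrite !mem_undup => ir.
  by apply/negP => /sr; rewrite ir.
- by apply: determined_by_sub dE => i; rewrite mem_undup.
- by apply: determined_by_sub dF => i; rewrite mem_undup.
Qed.

End independence.

(** * Integration over the fibers of an integer-valued variable *)

Section discrete_integrals.
Context {d} {T : measurableType d} {R : realType} (P : probability T R).
Variable V : T -> nat.
Hypothesis mV : forall v, measurable (V @^-1` [set v]).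

Lemma measurable_fun_fibers {d'} {U : measurableType d'} (f : T -> U) :
  (forall t t', V t = V t' -> f t = f t') -> measurable_fun setT f.
Proof.
move=> fV _ B mB; rewrite setTI.
rewrite (_ : f @^-1` B = \bigcup_v (V @^-1` [set v] `&` f @^-1` B)); last first.
  by apply/seteqP; split=> [t Bt|t [v _ []//]]; exists (V t).
apply: bigcupT_measurable => v.
have [[t [/= tv Bt]]|nB] := pselect (exists t, (V @^-1` [set v] `&` f @^-1` B) t).
  rewrite (_ : _ `&` _ = V @^-1` [set v])//; apply/seteqP; split=> [t' []//|t' /= t'v].
  by split=> //=; rewrite -(fV t) // tv t'v.
rewrite (_ : _ `&` _ = set0)//.
by apply/seteqP; split=> // t Bt; apply: nB; exists t.
Qed.

Lemma bigcup_fibers (E : set T) : \bigcup_v (E `&` V @^-1` [set v]) = E.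
Proof. by apply/seteqP; split=> [t [v _ []]//|t Et]; exists (V t). Qed.

Lemma trivIset_fibers (E : set T) :
  trivIset setT (fun v => E `&` V @^-1` [set v]).
Proof.
apply/trivIsetP => v w _ _ /eqP vw; apply/seteqP; split => // t.
by move=> [[_ /= tv] [_ /= tw]]; apply: vw; rewrite -tv -tw.
Qed.

Lemma ge0_integral_fibers (E : set T) (f : T -> R) : measurable E ->
  measurable_fun setT f -> (forall t, 0 <= f t) ->
  (\int[P]_(t in E) (f t)%:E
   = \sum_(v <oo) \int[P]_(t in E `&` V @^-1` [set v]) (f t)%:E)%E.
Proof.
move=> mE mf f0; rewrite -[in LHS](bigcup_fibers E) ge0_integral_bigcup//.
- by move=> v; exact: measurableI.
- by rewrite bigcup_fibers; apply/measurable_EFinP; exact: measurable_funTS.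
- by move=> t _; rewrite lee_fin.
- exact: trivIset_fibers.
Qed.

Lemma integral_fibers (f : T -> R) : P.-integrable setT (EFin \o f) ->
  (\int[P]_t (f t)%:E = \sum_(v <oo) \int[P]_(t in V @^-1` [set v]) (f t)%:E)%E.
Proof.
move=> intf; rewrite -[in LHS](bigcup_fibers setT) integral_bigcup//.
- by apply: eq_eseriesr => v _; rewrite setTI.
- exact: trivIset_fibers.
- by move=> v; rewrite setTI.
- by rewrite bigcup_fibers.
Qed.

Lemma ge0_integral_discrete (E : set T) (f : nat -> R) : measurable E ->
  (forall v, 0 <= f v) ->
  (\int[P]_(t in E) (f (V t))%:E
   = \sum_(v <oo) (f v)%:E * P (E `&` V @^-1` [set v]))%E.
Proof.
move=> mE f0; rewrite ge0_integral_fibers//; last first.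
  by apply: measurable_fun_fibers => t t' ->.
apply: eq_eseriesr => v _; rewrite -integral_cst; last exact: measurableI.
by apply: eq_integral => t; rewrite inE => -[_ /= ->].
Qed.

Lemma ge0_integral_indep (E : set T) (f : nat -> R) : measurable E ->
  (forall v, P (E `&` V @^-1` [set v]) = P E * P (V @^-1` [set v]))%E ->
  (forall v, 0 <= f v) ->
  (\int[P]_(t in E) (f (V t))%:E = P E * \int[P]_t (f (V t))%:E)%E.
Proof.
move=> mE indepEV f0; rewrite !ge0_integral_discrete//.
have PE : P E \is a fin_num by rewrite fin_num_measure.
rewrite -(fineK PE) -nneseriesZl => [|v _]; last by rewrite mule_ge0// lee_fin.
apply: eq_eseriesr => v _; rewrite fineK// setTI muleCA; congr (_ * _)%E.
by rewrite indepEV.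
Qed.

End discrete_integrals.

Lemma ge0_integral_eq_law {d} {T : measurableType d} {R : realType}
    (P : probability T R) (V W : T -> nat) (f : nat -> R) :
  (forall v, measurable (V @^-1` [set v])) ->
  (forall v, measurable (W @^-1` [set v])) ->
  (forall v, P (V @^-1` [set v]) = P (W @^-1` [set v])) ->
  (forall v, 0 <= f v) ->
  (\int[P]_t (f (V t))%:E = \int[P]_t (f (W t))%:E)%E.
Proof.
move=> mV mW VW f0; rewrite (ge0_integral_discrete P mV)//.
rewrite (ge0_integral_discrete P mW)//.
by apply: eq_eseriesr => v _; rewrite !setTI VW.
Qed.

Lemma ge0_integral_addBernoulli {d} {T : measurableType d} {R : realType}
    (P : probability T R) (V B : T -> nat) (p : R) (f : nat -> R) :
  0 <= p <= 1 ->
  (forall v, measurable (V @^-1` [set v])) ->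
  (forall v, measurable (B @^-1` [set v])) ->
  (forall b v, P (B @^-1` [set b] `&` V @^-1` [set v])
               = P (B @^-1` [set b]) * P (V @^-1` [set v]))%E ->
  P (B @^-1` [set 1%N]) = p%:E -> P (B @^-1` [set 0%N]) = (1 - p)%:E ->
  (forall v, 0 <= f v) ->
  (\int[P]_t (f (V t + B t)%N)%:E
   = \int[P]_t (p * f (V t).+1 + (1 - p) * f (V t))%:E)%E.
Proof.
move=> p01 mV mB indepBV B1 B0 f0.
have mf (g : nat -> R) : measurable_fun setT (fun t => (g (V t))%:E).
  by apply/measurable_EFinP; apply: (measurable_fun_fibers mV) => t t' ->.
have mVB : measurable_fun setT (fun t => f (V t + B t)%N).
  apply: (@measurable_fun_fibers _ _ (fun t => V t + B t)%N) => [c|t t' ->//].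
  rewrite (_ : _ @^-1` _ = \bigcup_(v in `I_c.+1)
      (V @^-1` [set v] `&` B @^-1` [set (c - v)%N])).
    by apply: bigcup_measurable => v _; exact: measurableI.
  apply/seteqP; split=> [t /= VBc|t [v /= vc [/= -> ->]]]; last by rewrite subnKC.
  by exists (V t); [rewrite /= -VBc ltnS leq_addr|split=> //=; rewrite -VBc addKn].
(* The two prescribed masses sum to 1, so all other values of [B] form a null event and the integral
   splits into two fibers. *)
have PU : P (B @^-1` [set 1%N] `|` B @^-1` [set 0%N]) = 1%:E.
  transitivity (P (B @^-1` [set 1%N]) + P (B @^-1` [set 0%N]))%E.
    by apply: measureU => //; apply/seteqP; split => // t [/= ->].
  by rewrite B1 B0 -EFinD addrC subrK.
have PN : P (~` (B @^-1` [set 1%N] `|` B @^-1` [set 0%N])) = 0%E.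
  by rewrite probability_setC ?PU ?subee//; exact: measurableU.
rewrite (ge0_negligible_integral _ _ _ _ PN)//.
- rewrite setTD setCK ge0_integral_setU//.
  + have Bb b : (\int[P]_(t in B @^-1` [set b]) (f (V t + B t)%N)%:E
        = P (B @^-1` [set b]) * \int[P]_t (f (V t + b)%N)%:E)%E.
      have /= <- := ge0_integral_indep mV (mB b) (indepBV b) (f := fun v => f (v + b)%N).
        by apply: eq_integral => t; rewrite inE /= => ->.
      by move=> v; exact: f0.
    rewrite !Bb B1 B0; under eq_integral do rewrite addn1.
    rewrite -!ge0_integralZl//; try by [move=> t _; rewrite lee_fin|rewrite lee_fin; lra].
    * rewrite -ge0_integralD//.
      - by apply: eq_integral => t _; rewrite addn0 -!EFinM -EFinD.
      - by move=> t _; rewrite -EFinM lee_fin mulr_ge0//; lra.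
      - exact: (mf (fun v => p * f v.+1)).
      - by move=> t _; rewrite -EFinM lee_fin mulr_ge0//; lra.
      - exact: (mf (fun v => (1 - p) * f (v + 0)%N)).
    * exact: (mf (fun v => f (v + 0)%N)).
    * exact: (mf (fun v => f v.+1)).
  + by apply/measurable_EFinP; exact: measurable_funTS.
  + by move=> t _; rewrite lee_fin.
  + by apply/disj_setPS => t [/= -> ].
- by apply: measurableC; exact: measurableU.
- exact/measurable_EFinP.
- by move=> t _; rewrite lee_fin.
Qed.

(** * The INAR(1) process *)

Section inar.
Context {d} {T : measurableType d} {R : realType} (P : probability T R).
Variables (alpha mu : R) (X0 : T -> nat) (eps : nat -> T -> nat).
Variable xi : nat -> nat -> T -> nat.
Hypothesis alpha01 : 0 < alpha < 1.
Hypothesis rvZ : nat_rvs (inar_family X0 eps xi).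
Hypothesis indepZ : mutually_independent P (inar_family X0 eps xi).
Hypothesis eps_law : forall k (B : set nat), P (eps k @^-1` B) = P (eps 0%N @^-1` B).
Hypothesis xi_law : forall k j, P (xi k j @^-1` [set 1%N]) = alpha%:E
  /\ P (xi k j @^-1` [set 0%N]) = (1 - alpha)%:E.
Hypothesis eps_moment2 : (\int[P]_t ((eps 0%N t ^ 2)%:R : R)%:E < +oo)%E.
Hypothesis eps_mean : (\int[P]_t ((eps 0%N t)%:R : R)%:E = mu%:E)%E.

Local Notation Z := (inar_family X0 eps xi).
Local Notation X := (inarX X0 eps xi).
Local Notation determined := (determined_by Z).

Definition traj (t : T) (k : nat) : nat := X k t.

(** The state at time [k.+1] if the state at time [k] were [x]: freezing [x] leaves a variable of
    fresh coordinates only. *)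
Definition offspring k x t : nat := (\sum_(0 <= j < x) xi k j t + eps k t)%N.

Definition future k x : seq inar_idx :=
  Some (inl k) :: [seq Some (inr (k, j)) | j <- iota 0 x].

(* The history up to [k] depends on finitely many of the [xi] only because the
   values [X i t0] are prescribed. *)
Definition past k t0 : seq inar_idx :=
  None :: [seq Some (inl i) | i <- iota 0 k]
    ++ [seq Some (inr (i, j)) | i <- iota 0 k, j <- iota 0 (X i t0)].

Lemma offspring_determined k x (B : set nat) :
  determined (future k x) (offspring k x @^-1` B).
Proof.
move=> t t' tt' /=; rewrite /offspring.
rewrite (tt' (Some (inl k)) (mem_head _ _) : eps k t = eps k t').
rewrite (_ : (\sum_(0 <= j < x) xi k j t)%N = (\sum_(0 <= j < x) xi k j t')%N)//.
apply: eq_big_nat => j /andP[_ jx]; apply: (tt' (Some (inr (k, j)))).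
by rewrite inE/= map_f// mem_iota.
Qed.

(** The past uses innovations of generations below [k], the future only those of generation [k]. *)
Lemma past_future k x t0 : {in past k t0, forall i, i \notin future k x}.
Proof.
move=> i; rewrite inE mem_cat => /or3P[/eqP->|/mapP[j]|].
- by rewrite inE/=; apply/mapP => -[].
- rewrite mem_iota/= => jk ->; rewrite inE negb_or; apply/andP; split.
    by apply/eqP => -[jE]; rewrite jE ltnn in jk.
  by apply/mapP => -[].
- move=> /allpairsPdep[j [l []]]; rewrite mem_iota/= => jk _ ->.
  rewrite inE/=; apply/mapP => -[m _ [jE _]]; by rewrite jE ltnn in jk.
Qed.

(** An atom of the sigma-algebra of the process up to time [k]. Integrals over these atoms stand in
    for conditional expectations. *)
Definition history k t0 : set T := [set t | forall i, (i <= k)%N -> X i t = X i t0].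

Lemma history_determined k t0 : determined (past k t0) (history k t0).
Proof.
move=> t t' tt' tt0 i; elim: i => [_|i IH ik].
  by rewrite -tt0//; apply/esym/(tt' None)/mem_head.
rewrite -tt0//= (IH (ltnW ik)) (tt0 _ (ltnW ik)).
have it : Some (inl i) \in past k t0.
  by rewrite inE mem_cat map_f// mem_iota.
rewrite -(tt' _ it : eps i t = eps i t'); congr (_ + _)%N.
apply: eq_big_nat => j /andP[_ jx]; apply/esym/(tt' (Some (inr (i, j)))).
rewrite inE mem_cat; apply/orP; right; apply/orP; right.
by apply/allpairsPdep; exists i, j; rewrite !mem_iota.
Qed.

Lemma measurable_history k t0 : measurable (history k t0).
Proof. exact: (measurable_determined rvZ (@history_determined k t0)). Qed.

Lemma measurable_offspring k x v : measurable (offspring k x @^-1` [set v]).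
Proof. exact: (measurable_determined rvZ (@offspring_determined k x [set v])). Qed.

Lemma history_offspring_indep k x t0 v :
  P (history k t0 `&` offspring k x @^-1` [set v])
  = (P (history k t0) * P (offspring k x @^-1` [set v]))%E.
Proof.
apply: (independent_disjoint rvZ indepZ (@past_future k x t0)).
  exact: history_determined.
exact: offspring_determined.
Qed.

(** One integer for the whole path up to [k], so that the nonempty fibers of this variable are the
    atoms. *)
Definition history_code k t : nat := pickle [seq X i t | i <- iota 0 k.+1].

Lemma history_codeE k t t' :
  history_code k t = history_code k t' <-> history k t' t.
Proof.
split=> [/(pcan_inj pickleK) E i ik|tt'].
  have := congr1 (fun s => nth 0%N s i) E.
  by rewrite !(nth_map 0%N) ?size_iota// nth_iota.
by congr pickle; apply/eq_in_map => i; rewrite mem_iota/= add0n ltnS => /tt'.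
Qed.

Lemma history_code_fiber k n :
  history_code k @^-1` [set n] = set0 \/
  exists t0, history_code k @^-1` [set n] = history k t0.
Proof.
have [[t0 /= t0n]|nE] := pselect (exists t, (history_code k @^-1` [set n]) t).
  right; exists t0; apply/seteqP; split=> t /=.
    by rewrite -t0n => /history_codeE.
  by rewrite -t0n => /history_codeE.
by left; apply/seteqP; split=> // t nt; apply: nE; exists t.
Qed.

Lemma measurable_history_code k n : measurable (history_code k @^-1` [set n]).
Proof.
have [->//|[t0 ->]] := history_code_fiber k n; exact: measurable_history.
Qed.

(** Adaptedness to the natural filtration, expressed on path functionals. *)
Definition adapted k (G : (nat -> nat) -> R) : Prop :=
  forall x x', (forall i, (i <= k)%N -> x i = x' i) -> G x = G x'.

Lemma measurable_adapted k G : adapted k G ->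
  measurable_fun setT (fun t => G (traj t)).
Proof.
move=> Gk; apply: (measurable_fun_fibers (@measurable_history_code k)) => t t'.
by move=> /history_codeE tt'; apply: Gk.
Qed.

(** * Moments of one generation *)

Lemma measurable_eps k v : measurable (eps k @^-1` [set v]).
Proof. exact: (rvZ (Some (inl k))). Qed.

(* The moments of [offspring k x] follow by induction on [x]: averaging over one
   more Bernoulli variable turns [f v] into [alpha f (v + 1) + (1 - alpha) f v]. *)
Lemma ge0_integral_offspring0 k (f : nat -> R) : (forall v, 0 <= f v) ->
  (\int[P]_t (f (offspring k 0 t))%:E = \int[P]_t (f (eps 0%N t))%:E)%E.
Proof.
move=> f0; rewrite -(@ge0_integral_eq_law _ _ _ P (eps k) (eps 0%N))//.
- by apply: eq_integral => t _; rewrite /offspring big_geq.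
- exact: measurable_eps.
- exact: measurable_eps.
Qed.

Lemma ge0_integral_offspringS k x (f : nat -> R) : (forall v, 0 <= f v) ->
  (\int[P]_t (f (offspring k x.+1 t))%:E
   = \int[P]_t (alpha * f (offspring k x t).+1
                + (1 - alpha) * f (offspring k x t))%:E)%E.
Proof.
move=> f0; rewrite -(@ge0_integral_addBernoulli _ _ _ P (offspring k x) (xi k x))//.
- apply: eq_integral => t _; rewrite /offspring big_nat_recr//=.
  by rewrite addnAC.
- by case/andP: alpha01 => /ltW-> /ltW->.
- exact: measurable_offspring.
- by move=> v; exact: (rvZ (Some (inr (k, x)))).
- move=> b v; apply: (independent_disjoint (s := [:: Some (inr (k, x))])
    rvZ indepZ _ _ (@offspring_determined k x [set v])).
    move=> i; rewrite !inE => /eqP->/=; apply/mapP => -[j].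
    by rewrite mem_iota/= => jx [xj]; rewrite xj ltnn in jx.
  by move=> t t' tt' /= <-; apply/esym; apply: (tt' (Some (inr (k, x)))); exact: mem_head.
- by have [] := xi_law k x.
- by have [] := xi_law k x.
Qed.

Lemma measurable_fun_offspring k x (f : nat -> R) :
  measurable_fun setT (fun t => f (offspring k x t)).
Proof.
by apply: (measurable_fun_fibers (@measurable_offspring k x)) => t t' ->.
Qed.

Lemma offspring_mean k x :
  (\int[P]_t (offspring k x t)%:R%:E = (alpha * x%:R + mu)%:E)%E.
Proof.
elim: x => [|x IH].
  by rewrite (@ge0_integral_offspring0 _ (fun v => v%:R))// mulr0 add0r eps_mean.
rewrite (@ge0_integral_offspringS _ _ (fun v => v%:R))//.
transitivity (\int[P]_t ((offspring k x t)%:R%:E + alpha%:E))%E.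
  by apply: eq_integral => t _; rewrite -EFinD -natr1; congr (EFin _); ring.
rewrite ge0_integralD//.
- rewrite IH integral_cst//= probability_setT mule1 -EFinD -natr1.
  by congr (EFin _); ring.
- apply/measurable_EFinP.
  exact: (@measurable_fun_offspring k x (fun v => v%:R)).
- by move=> t _; case/andP: alpha01 => /ltW.
Qed.

(** With [z] the deviation of [offspring k x] from its mean, [alpha (z + 1 - alpha)^2 + (1 - alpha)
    (z - alpha)^2 = z^2 + alpha (1 - alpha)]: each parent adds one Bernoulli variance. *)
Lemma offspring_variance k x :
  (\int[P]_t (((offspring k x t)%:R - (alpha * x%:R + mu)) ^+ 2)%:E
   = \int[P]_t (((eps 0%N t)%:R - mu) ^+ 2)%:E + (alpha * (1 - alpha) * x%:R)%:E)%E.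
Proof.
elim: x => [|x IH].
  rewrite (@ge0_integral_offspring0 _ (fun v => (v%:R - (alpha * 0%:R + mu)) ^+ 2)).
    by rewrite !mulr0 adde0 add0r.
  by move=> v; rewrite sqr_ge0.
rewrite (@ge0_integral_offspringS _ _ (fun v => (v%:R - (alpha * x.+1%:R + mu)) ^+ 2)).
  transitivity (\int[P]_t ((((offspring k x t)%:R - (alpha * x%:R + mu)) ^+ 2)%:E
                           + (alpha * (1 - alpha))%:E))%E.
    by apply: eq_integral => t _; rewrite -EFinD -!natr1; congr (EFin _); ring.
  have a0 : 0 <= alpha * (1 - alpha) by have := alpha01; nra.
  rewrite ge0_integralD//.
  - rewrite IH integral_cst//= probability_setT mule1 -addeA -EFinD -natr1.
    by congr (_ + EFin _)%E; ring.
  - by move=> t _; rewrite lee_fin sqr_ge0.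
  - apply/measurable_EFinP.
    exact: (@measurable_fun_offspring k x (fun v => (v%:R - (alpha * x%:R + mu)) ^+ 2)).
by move=> v; rewrite sqr_ge0.
Qed.

Lemma eps_variance_lty : (\int[P]_t (((eps 0%N t)%:R - mu) ^+ 2)%:E < +oo)%E.
Proof.
have mf (f : nat -> R) : measurable_fun setT (fun t => f (eps 0%N t)).
  by apply: (measurable_fun_fibers (@measurable_eps 0)) => t t' ->.
apply: (@le_lt_trans _ _
    (\int[P]_t (2 * ((eps 0%N t ^ 2)%:R : R)%:E + (2 * mu ^+ 2)%:E))%E).
  apply: ge0_le_integral => //.
  - by move=> t _; rewrite lee_fin sqr_ge0.
  - by apply/measurable_EFinP; exact: (mf (fun v => (v%:R - mu) ^+ 2)).
  - by apply/measurable_EFinP; exact: (mf (fun v => 2 * (v ^ 2)%:R + 2 * mu ^+ 2)).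
  - move=> t _; rewrite -EFinM -EFinD lee_fin natrX.
    by have := sqr_ge0 ((eps 0%N t)%:R + mu); lra.
rewrite ge0_integralD//.
- rewrite integral_cst//= probability_setT mule1 ge0_integralZl//.
  + by rewrite lte_add_pinfty ?ltry// lte_mul_pinfty.
  + by apply/measurable_EFinP; exact: (mf (fun v => (v ^ 2)%:R)).
- by apply/measurable_EFinP; exact: (mf (fun v => 2 * (v ^ 2)%:R)).
- by move=> t _; rewrite lee_fin mulr_ge0 ?sqr_ge0.
Qed.

(** * The martingale difference property *)

Lemma traj_history k t t0 : history k t0 t ->
  forall i, (i <= k)%N -> traj t i = traj t0 i.
Proof. by []. Qed.

Lemma noise_history k t t0 : history k t0 t ->
  noise alpha mu (traj t) k
  = (offspring k (X k t0) t)%:R - (alpha * (X k t0)%:R + mu).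
Proof. by move=> /(_ k (leqnn k)) tt0; rewrite /noise /traj /= tt0 opprD addrA. Qed.

Lemma integrable_offspring k x :
  P.-integrable setT (fun t => ((offspring k x t)%:R : R)%:E).
Proof.
apply/integrableP; split.
  apply/measurable_EFinP; exact: (@measurable_fun_offspring k x (fun v => v%:R)).
by under eq_integral do rewrite gee0_abs//; rewrite offspring_mean ltry.
Qed.

(** On each atom [G] is constant and the noise is an offspring variable minus its mean, independent
    of the atom; integrability permits summing over atoms. *)
Lemma integral_adapted_noise k G : adapted k G ->
  P.-integrable setT (fun t => (G (traj t) * noise alpha mu (traj t) k)%:E) ->
  (\int[P]_t (G (traj t) * noise alpha mu (traj t) k)%:E = 0)%E.
Proof.
move=> Gk intG; rewrite (integral_fibers (@measurable_history_code k) intG).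
rewrite eseries0// => n _ _; have [->|[t0 ->]] := history_code_fiber k n.
  exact: integral_set0.
have mH := @measurable_history k t0; set x := X k t0.
transitivity (\int[P]_(t in history k t0)
    ((G (traj t0))%:E * ((offspring k x t)%:R%:E - (alpha * x%:R + mu)%:E)))%E.
  apply: eq_integral => t; rewrite inE => tt0.
  by rewrite (noise_history tt0) -EFinB -EFinM (Gk _ _ (traj_history tt0)).
have io : P.-integrable (history k t0) (fun t => ((offspring k x t)%:R : R)%:E).
  by apply: integrableS (integrable_offspring k x).
have ic : P.-integrable (history k t0) (cst (alpha * x%:R + mu)%:E).
  exact: finite_measure_integrable_cst.
rewrite integralZl//; last exact: integrableB.
rewrite integralB// integral_cst//.
rewrite (@ge0_integral_indep _ _ _ P _ (@measurable_offspring k x) _ (fun v => v%:R))//.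
  rewrite offspring_mean (muleC (P _)) subee ?mule0//.
  by rewrite fin_numM// fin_num_measure.
exact: history_offspring_indep.
Qed.

(** Again atom by atom: with [s] the variance of the innovations, the conditional variance
    [s + alpha (1 - alpha) x] is at most [(1 + s) (1 + x)]. Both integrals may be infinite. *)
Lemma integral_adapted_noise_sqr : exists2 K : R, 0 <= K & forall k G,
  adapted k G ->
  (\int[P]_t (G (traj t) ^+ 2 * noise alpha mu (traj t) k ^+ 2)%:E
   <= \int[P]_t (K * (G (traj t) ^+ 2 * (1 + (traj t k)%:R)))%:E)%E.
Proof.
pose s := (\int[P]_t (((eps 0%N t)%:R - mu) ^+ 2)%:E)%E.
have s0 : (0 <= s)%E by apply: integral_ge0 => t _; rewrite lee_fin sqr_ge0.
have sfin : s \is a fin_num by rewrite ge0_fin_numE// eps_variance_lty.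
have fs0 : 0 <= fine s by rewrite fine_ge0.
exists (1 + fine s) => [|k G Gk]; first exact: addr_ge0.
have GX : adapted k (fun x => (1 + fine s) * (G x ^+ 2 * (1 + (x k)%:R))).
  by move=> x x' xx'; rewrite (Gk _ _ xx') xx'.
have mn : measurable_fun setT
    (fun t => G (traj t) ^+ 2 * noise alpha mu (traj t) k ^+ 2).
  apply: (@measurable_adapted k.+1 (fun x => G x ^+ 2 * noise alpha mu x k ^+ 2)).
  move=> x x' xx'; rewrite /noise !xx'// (Gk x x')// => i ik.
  by rewrite xx'// leqW.
rewrite (ge0_integral_fibers P (@measurable_history_code k))//; last first.
  by move=> t; rewrite mulr_ge0 ?sqr_ge0.
rewrite (ge0_integral_fibers P (@measurable_history_code k))//; last 2 first.
  exact: (measurable_adapted GX).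
  by move=> t; rewrite mulr_ge0 ?addr_ge0// mulr_ge0 ?sqr_ge0 ?addr_ge0.
apply: lee_nneseries => [n _ _|n _].
  by apply: integral_ge0 => t _; rewrite lee_fin mulr_ge0 ?sqr_ge0.
rewrite setTI; have [->|[t0 ->]] := history_code_fiber k n.
  by rewrite !integral_set0.
have mH := @measurable_history k t0; set x := X k t0.
have PH : P (history k t0) \is a fin_num by rewrite fin_num_measure.
rewrite (_ : (\int[P]_(t in _) (_ * noise _ _ _ _ ^+ 2)%:E)%E =
   (\int[P]_(t in history k t0)
     (G (traj t0) ^+ 2 * ((offspring k x t)%:R - (alpha * x%:R + mu)) ^+ 2)%:E)%E); last first.
  apply: eq_integral => t; rewrite inE => tt0.
  by rewrite (noise_history tt0) (Gk _ _ (traj_history tt0)).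
rewrite (@ge0_integral_indep _ _ _ P _ (@measurable_offspring k x) _
  (fun v => G (traj t0) ^+ 2 * (v%:R - (alpha * x%:R + mu)) ^+ 2))//; last 2 first.
- exact: history_offspring_indep.
- by move=> v; rewrite mulr_ge0 ?sqr_ge0.
rewrite (_ : (\int[P]_(t in history k t0)
    ((1 + fine s) * (G (traj t) ^+ 2 * (1 + (traj t k)%:R)))%:E)%E = (\int[P]_(t in history k t0)
   cst ((1 + fine s) * (G (traj t0) ^+ 2 * (1 + x%:R)))%:E t)%E); last first.
  apply: eq_integral => t; rewrite inE => tt0 /=; congr EFin.
  exact: GX (traj_history tt0).
rewrite integral_cst// muleC lee_wpmul2r ?fine_ge0//.
under eq_integral do rewrite EFinM.
rewrite ge0_integralZl//; first last.
- by rewrite lee_fin sqr_ge0.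
- by move=> t _; rewrite lee_fin sqr_ge0.
- apply/measurable_EFinP.
  exact: (@measurable_fun_offspring k x (fun v => (v%:R - (alpha * x%:R + mu)) ^+ 2)).
rewrite offspring_variance -/s -(fineK sfin) -EFinD -EFinM lee_fin.
rewrite mulrCA ler_wpM2l ?sqr_ge0//.
have x0 : 0 <= x%:R :> R by [].
have := mulr_ge0 fs0 x0; have := alpha01; have := fs0.
move=> fs /andP[a0 a1] sx.
have : alpha * (1 - alpha) * x%:R <= 1 * x%:R by rewrite ler_wpM2r//; nra.
lra.
Qed.

(** * Stopping and the maximal inequality *)

Definition increment x k : R := weight x k * noise alpha mu x k.

(* [stopped e m n] is the martingale [\sum_(m <= k < n) increment k] stopped when
   its absolute value first reaches [e]: its final value is then at least [e], so
   Chebyshev's inequality for it is a maximal inequality. *)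
Definition below (e : R) m k x : bool :=
  [forall j : 'I_k.+1, (m <= j)%N ==> (`|\sum_(m <= i < j) increment x i| < e)].

Definition stopped e m n x : R :=
  \sum_(m <= k < n) (below e m k x)%:R * increment x k.

Definition invsqrt n x : R := (Num.sqrt (1 + sqsum x n))^-1.

Lemma adapted_sqsum k n : (n <= k.+1)%N -> adapted k (fun x => sqsum x n).
Proof.
move=> nk x x' xx'; rewrite /sqsum; apply: eq_big_nat => i /andP[_ ltin].
by rewrite xx'// -ltnS (leq_trans ltin).
Qed.

Lemma adapted_weight k : adapted k (fun x => weight x k).
Proof. by move=> x x' xx'; rewrite /weight (adapted_sqsum (leqnn _) xx') xx'. Qed.

Lemma adapted_increment k n : (k < n)%N -> adapted n (fun x => increment x k).
Proof.
move=> kn x x' xx'; rewrite /increment /noise !xx' ?(ltnW kn)//.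
by rewrite (@adapted_weight k x x')// => i ik; rewrite xx'// (leq_trans ik)// ltnW.
Qed.

(** The sums tested contain only increments of index below [k], known at time [k]: the decision to
    continue precedes the next noise. *)
Lemma adapted_below e m k : adapted k (fun x => (below e m k x)%:R).
Proof.
move=> x x' xx'; congr (nat_of_bool _)%:R; apply: eq_forallb => j.
congr (_ ==> (`|_| < e)); apply: eq_big_nat => i /andP[_ ij].
by apply: (@adapted_increment i k _ _ _ xx'); rewrite -ltnS (leq_trans _ (ltn_ord j)).
Qed.

Lemma adapted_stopped e m n : adapted n (stopped e m n).
Proof.
move=> x x' xx'; apply: eq_big_nat => k /andP[_ kn].
rewrite (@adapted_increment k n kn _ _ xx'); congr (_ * _).
by apply: adapted_below => i ik; rewrite xx'// (leq_trans ik)// ltnW.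
Qed.

Lemma adapted_invsqrt n : adapted n (invsqrt n).
Proof. by move=> x x' xx'; rewrite /invsqrt (adapted_sqsum (leqnSn _) xx'). Qed.

Lemma invsqrt_gt0 n x : 0 < invsqrt n x.
Proof. by rewrite invr_gt0 sqrtr_gt0 ltr_pwDl ?sqsum_ge0. Qed.

Lemma invsqrt_le1 n x : invsqrt n x <= 1.
Proof.
rewrite invf_le1 ?sqrtr_gt0 ?ltr_pwDl ?sqsum_ge0//.
by rewrite -[leLHS]sqrtr1 ler_wsqrtr// lerDl sqsum_ge0.
Qed.

Lemma invsqrt_nincr m n x : (m <= n)%N -> invsqrt n x <= invsqrt m x.
Proof.
move=> mn; have b k : 0 < 1 + sqsum x k :> R by rewrite ltr_pwDl ?sqsum_ge0.
by rewrite lef_pV2 ?posrE ?sqrtr_gt0// ler_wsqrtr// lerD2l; exact: sqsum_nd.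
Qed.

(* With [b = 1 + x_0^2 + ... + x_k^2], the left-hand side is at most
   [2 x_k^3 / b^2 <= 2 x_k^2 / b^(3/2)], which telescopes. *)
Lemma weight_telescope k x :
  weight x k ^+ 2 * (1 + (x k)%:R) <= 4 * (invsqrt k x - invsqrt k.+1 x).
Proof.
have b n : 0 < 1 + sqsum x n :> R by rewrite ltr_pwDl ?sqsum_ge0.
rewrite /weight /invsqrt; set r := Num.sqrt (1 + sqsum x k).
set q := Num.sqrt (1 + sqsum x k.+1).
have r0 : 0 < r by rewrite sqrtr_gt0.
have q0 : 0 < q by rewrite sqrtr_gt0.
have rq : r <= q by rewrite ler_wsqrtr// lerD2l sqsumS lerDl sqr_ge0.
have r2 : r ^+ 2 = 1 + sqsum x k by rewrite sqr_sqrtr// ltW.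
have q2 : q ^+ 2 = 1 + sqsum x k.+1 by rewrite sqr_sqrtr// ltW.
rewrite -q2; set y : R := (x k)%:R.
have y2 : y ^+ 2 = (q - r) * (q + r).
  by rewrite -subr_sqr q2 r2 sqsumS; ring.
have y0 : 0 <= y by [].
have yq : y <= q.
  rewrite -(@ler_pXn2r _ 2) ?nnegrE ?(ltW q0)// y2.
  by have := sqr_ge0 r; lra.
have [yE|xk0] := eqVneq (x k) 0%N.
  rewrite /y yE mul0r expr0n/= mul0r mulr_ge0// subr_ge0 lef_pV2 ?posrE//.
have y1 : 1 <= y by rewrite ler1n lt0n.
rewrite [leLHS](_ : _ = y ^+ 2 * (1 + y) / q ^+ 4); last by field; rewrite gt_eqF.
rewrite [leRHS](_ : _ = 4 * (q - r) / (r * q)); last by field; rewrite !gt_eqF.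
rewrite ler_pdivrMr ?exprn_gt0// (mulrAC (4 * (q - r))) ler_pdivlMr ?mulr_gt0// y2.
have qr0 : 0 <= q - r by lra.
rewrite [leLHS](_ : _ = (q - r) * ((q + r) * (1 + y) * (r * q))); last by ring.
rewrite [leRHS](_ : _ = (q - r) * (4 * q ^+ 4)); last by ring.
rewrite ler_wpM2l//.
(* The factors are compared one by one: [r <= q], and [1 + y <= 2 y <= 2 q] because a nonzero [x k]
   is at least 1. *)
rewrite [leRHS](_ : _ = (q + q) * (q + q) * (q * q)); last by ring.
rewrite ler_pM ?mulr_ge0 ?addr_ge0 ?(ltW r0) ?(ltW q0)//.
  by rewrite ler_pM ?addr_ge0 ?(ltW r0) ?(ltW q0)//; lra.
by rewrite ler_wpM2r// ltW.
Qed.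

(** At the least [j] where the partial sum reaches [e], the indicators are 1 before [j] and 0 from
    [j] on, so the stopped sum equals that partial sum. *)
Lemma stopped_ge e m n x : 0 < e -> ~~ below e m n x -> e <= `|stopped e m n x|.
Proof.
move=> e0 /forallPn /= [j0]; rewrite negb_imply -leNgt => /andP[mj0 ej0].
have ex : exists j, (m <= j)%N && (e <= `|\sum_(m <= i < j) increment x i|).
  by exists j0; rewrite mj0.
case: (ex_minnP ex) => j /andP[mj ej] jmin.
have jn : (j <= n)%N.
  by rewrite (leq_trans (jmin j0 _)) ?mj0 ?ej0// -ltnS.
rewrite /stopped (big_cat_nat mj jn)/= [X in _ + X]big1_seq.
  rewrite addr0 (_ : \sum_(m <= k < j) _ = \sum_(m <= i < j) increment x i)//.
  apply: eq_big_nat => k /andP[mk kj]; rewrite (_ : below e m k x) ?mul1r//.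
  apply/forallP => i; apply/implyP => mi; rewrite ltNge; apply/negP => ei.
  have := jmin i; rewrite mi ei => /(_ isT) ji.
  by have := ltn_ord i; rewrite ltnS leqNgt (leq_trans kj ji).
move=> k /=; rewrite mem_index_iota => /andP[jk _].
rewrite (_ : below e m k x = false) ?mul0r//; apply/negbTE/forallPn.
by exists (Ordinal (jk : j < k.+1)%N); rewrite /= negb_imply mj -leNgt.
Qed.

Lemma integrable_adapted_le k G (F : (nat -> nat) -> R) n :
  adapted k G -> adapted n F -> (forall x, `|G x| <= F x) ->
  P.-integrable setT (fun t => (F (traj t))%:E) ->
  P.-integrable setT (fun t => (G (traj t))%:E).
Proof.
move=> Gk Fn GF; apply: le_integrable => // [|t _].
  by apply/measurable_EFinP; exact: measurable_adapted Gk.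
by rewrite /= lee_fin (le_trans (GF _))// ler_norm.
Qed.

Lemma ge0_integrable_adapted k G : adapted k G -> (forall x, 0 <= G x) ->
  (\int[P]_t (G (traj t))%:E < +oo)%E ->
  P.-integrable setT (fun t => (G (traj t))%:E).
Proof.
move=> Gk G0 Goo; apply/integrableP; split.
  by apply/measurable_EFinP; exact: measurable_adapted Gk.
by under eq_integral do rewrite gee0_abs ?lee_fin//.
Qed.

Lemma integrable_bounded_adapted k G (c : R) : adapted k G ->
  (forall x, `|G x| <= c) -> P.-integrable setT (fun t => (G (traj t))%:E).
Proof.
move=> Gk Gc; apply: (integrable_adapted_le (n := 0%N) (F := fun=> c) Gk) => //.
exact: finite_measure_integrable_cst.
Qed.

Lemma stoppedS e m n x : (m <= n)%N ->
  stopped e m n.+1 x = stopped e m n x + (below e m n x)%:R * increment x n.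
Proof. by move=> mn; rewrite /stopped big_nat_recr. Qed.

(** Induction on [n]: expanding the square, the cross term integrates to 0 and the new square is
    bounded by the next telescoping difference. *)
Lemma stopped_energy : exists2 K : R, 0 <= K & forall e m n, (m <= n)%N ->
  (\int[P]_t (stopped e m n (traj t) ^+ 2)%:E
   <= \int[P]_t (K * (invsqrt m (traj t) - invsqrt n (traj t)))%:E)%E.
Proof.
have [K0 K00 hK0] := integral_adapted_noise_sqr.
exists (K0 * 4) => [|e m n]; first by rewrite mulr_ge0.
have K0' : 0 <= K0 * 4 by rewrite mulr_ge0.
have bound0 i j x : (i <= j)%N -> 0 <= K0 * 4 * (invsqrt i x - invsqrt j x).
  by move=> ij; rewrite mulr_ge0// subr_ge0 invsqrt_nincr.
have bound_adapted i j : (i <= j)%N ->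
    adapted j (fun x => K0 * 4 * (invsqrt i x - invsqrt j x)).
  move=> ij x x' xx'; rewrite (@adapted_invsqrt j x x')// (@adapted_invsqrt i x x')// => l li.
  by rewrite xx'// (leq_trans li).
have bound_lty i j : (i <= j)%N ->
    (\int[P]_t (K0 * 4 * (invsqrt i (traj t) - invsqrt j (traj t)))%:E < +oo)%E.
  move=> ij; apply: (@le_lt_trans _ _ (\int[P]_t (cst (K0 * 4)%:E t))%E).
    apply: ge0_le_integral => //.
    - by move=> t _; rewrite lee_fin bound0.
    - by apply/measurable_EFinP; exact: measurable_adapted (bound_adapted _ _ ij).
    - move=> t _; rewrite lee_fin ler_piMr//.
      by have := invsqrt_le1 i (traj t); have := invsqrt_gt0 j (traj t); lra.
  by rewrite integral_cst//= probability_setT mule1 ltry.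
elim: n => [|n IH]; rewrite leq_eqVlt => /predU1P[->|].
- under eq_integral do rewrite /stopped big_geq// expr0n/=.
  by rewrite integral0; apply: integral_ge0 => t _; rewrite lee_fin bound0.
- by rewrite ltn0.
- under eq_integral do rewrite /stopped big_geq// expr0n/=.
  by rewrite integral0; apply: integral_ge0 => t _; rewrite lee_fin bound0.
rewrite ltnS => mn; have {}IH := IH mn.
pose Z x := stopped e m n x; pose S x : R := (below e m n x)%:R * weight x n.
have Sn : adapted n S.
  by move=> x x' xx'; rewrite /S (@adapted_below e m n _ _ xx') (@adapted_weight n _ _ xx').
have Zn : adapted n Z := @adapted_stopped e m n.
have noiseS : adapted n.+1 (fun x => noise alpha mu x n).
  by move=> x x' xx'; rewrite /noise !xx'.
have lift G : adapted n G -> adapted n.+1 G.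
  by move=> Gn x x' xx'; apply: Gn => i /leqW; exact: xx'.
have Z2 : P.-integrable setT (fun t => (Z (traj t) ^+ 2)%:E).
  apply: (ge0_integrable_adapted (k := n) (G := fun x => Z x ^+ 2)) => [x x' xx'|x|].
  - by rewrite (Zn _ _ xx').
  - by rewrite sqr_ge0.
  - exact: le_lt_trans IH (bound_lty _ _ mn).
have SN_le : (\int[P]_t (S (traj t) ^+ 2 * noise alpha mu (traj t) n ^+ 2)%:E
    <= \int[P]_t (K0 * 4 * (invsqrt n (traj t) - invsqrt n.+1 (traj t)))%:E)%E.
  apply: le_trans (hK0 n S Sn) _; apply: ge0_le_integral => //.
  - by move=> t _; rewrite lee_fin mulr_ge0// mulr_ge0 ?sqr_ge0// addr_ge0.
  - apply/measurable_EFinP; apply: (measurable_adapted (k := n)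
      (G := fun x => K0 * (S x ^+ 2 * (1 + (x n)%:R)))).
    by move=> x x' xx'; rewrite (Sn _ _ xx') xx'.
  - by apply/measurable_EFinP; exact: measurable_adapted (bound_adapted _ _ (leqnSn n)).
  - move=> t _; rewrite lee_fin -mulrA ler_wpM2l//.
    apply: le_trans (weight_telescope n (traj t)).
    rewrite ler_wpM2r ?addr_ge0// /S exprMn ler_piMl ?sqr_ge0//.
    by case: (below _ _ _ _); rewrite ?expr1n// expr0n.
have SN2 : P.-integrable setT
    (fun t => (S (traj t) ^+ 2 * noise alpha mu (traj t) n ^+ 2)%:E).
  apply: (ge0_integrable_adapted (k := n.+1)
    (G := fun x => S x ^+ 2 * noise alpha mu x n ^+ 2)) => [x x' xx'|x|].
  - by rewrite (lift _ Sn _ _ xx') (noiseS _ _ xx').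
  - by rewrite mulr_ge0 ?sqr_ge0.
  - exact: le_lt_trans SN_le (bound_lty _ _ (leqnSn n)).
(* Dominated through [|2 Z S N| <= Z^2 + S^2 N^2], where [Z^2] is integrable by the induction
   hypothesis. *)
have ZSN : P.-integrable setT
    (fun t => (2 * (Z (traj t) * S (traj t)) * noise alpha mu (traj t) n)%:E).
  apply: (integrable_adapted_le (k := n.+1) (n := n.+1)
    (G := fun x => 2 * (Z x * S x) * noise alpha mu x n)
    (F := fun x => Z x ^+ 2 + S x ^+ 2 * noise alpha mu x n ^+ 2)).
  - by move=> x x' xx'; rewrite (lift _ Sn _ _ xx') (lift _ Zn _ _ xx') (noiseS _ _ xx').
  - by move=> x x' xx'; rewrite (lift _ Sn _ _ xx') (lift _ Zn _ _ xx') (noiseS _ _ xx').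
  - move=> x; have := sqr_ge0 (Z x + S x * noise alpha mu x n).
    have := sqr_ge0 (Z x - S x * noise alpha mu x n).
    by rewrite ler_norml => ? ?; apply/andP; split; lra.
  - by apply: eq_integrable (integrableD _ Z2 SN2).
have cross := integral_adapted_noise (k := n) (G := fun x => 2 * (Z x * S x)) _ ZSN.
rewrite (_ : (\int[P]_t (stopped e m n.+1 (traj t) ^+ 2)%:E)%E =
  (\int[P]_t ((Z (traj t) ^+ 2)%:E + ((2 * (Z (traj t) * S (traj t))
       * noise alpha mu (traj t) n)%:E
     + (S (traj t) ^+ 2 * noise alpha mu (traj t) n ^+ 2)%:E)))%E); last first.
  apply: eq_integral => t _; rewrite -!EFinD stoppedS// /Z /S /increment.
  by congr (EFin _); ring.
rewrite (_ : (\int[P]_t (K0 * 4 * (invsqrt m (traj t) - _))%:E)%E =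
  (\int[P]_t ((K0 * 4 * (invsqrt m (traj t) - invsqrt n (traj t)))%:E
     + (K0 * 4 * (invsqrt n (traj t) - invsqrt n.+1 (traj t)))%:E))%E); last first.
  by apply: eq_integral => t _; rewrite -!EFinD; congr (EFin _); ring.
rewrite integralD//; last exact: integrableD.
rewrite integralD// cross ?add0e; last first.
  by move=> x x' xx'; rewrite (Zn _ _ xx') (Sn _ _ xx').
rewrite ge0_integralD//.
- exact: leeD.
- by move=> t _; rewrite lee_fin bound0.
- by apply/measurable_EFinP; exact: measurable_adapted (bound_adapted _ _ mn).
- by move=> t _; rewrite lee_fin bound0.
- by apply/measurable_EFinP; exact: measurable_adapted (bound_adapted _ _ (leqnSn n)).
Qed.

Lemma measurable_not_below e m n : measurable [set t | ~~ below e m n (traj t)].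
Proof.
have := measurable_adapted (@adapted_below e m n) measurableT
  (measurable_set1 (0 : R)); rewrite setTI.
rewrite (_ : _ @^-1` _ = [set t | ~~ below e m n (traj t)])//.
apply/seteqP; split=> t /=; case: (below _ _ _ _) => //=.
by move=> /eqP; rewrite oner_eq0.
Qed.

Lemma chebyshev_stopped e m n : 0 < e ->
  ((e ^+ 2)%:E * P [set t | ~~ below e m n (traj t)]
   <= \int[P]_t (stopped e m n (traj t) ^+ 2)%:E)%E.
Proof.
move=> e0; set E := [set t | _].
have mE : measurable E := @measurable_not_below e m n.
have ms : measurable_fun setT (fun t => (stopped e m n (traj t) ^+ 2)%:E).
  apply/measurable_EFinP; apply: (measurable_adapted (k := n)
    (G := fun x => stopped e m n x ^+ 2)) => x x' xx'.
  by rewrite (@adapted_stopped e m n _ _ xx').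
rewrite -integral_cst//.
apply: (@le_trans _ _ (\int[P]_(t in E) (stopped e m n (traj t) ^+ 2)%:E)%E).
  apply: ge0_le_integral => //.
  - by move=> t _; rewrite lee_fin sqr_ge0.
  - exact: measurable_funTS.
  - move=> t Et; rewrite lee_fin -[leRHS]real_normK ?num_real//.
    by rewrite ler_pXn2r ?nnegrE ?(ltW e0)// stopped_ge.
apply: ge0_subset_integral => //.
by move=> t _; rewrite lee_fin sqr_ge0.
Qed.

(** The expectations are nonincreasing and nonnegative, hence converge, whatever the limit. *)
Lemma expected_invsqrt_cauchy : forall e : R, 0 < e -> exists m, forall n, (m <= n)%N ->
  (\int[P]_t (invsqrt m (traj t) - invsqrt n (traj t))%:E <= e%:E)%E.
Proof.
move=> e e0; pose U n := (\int[P]_t (invsqrt n (traj t))%:E)%E.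
have int_inv n : P.-integrable setT (fun t => (invsqrt n (traj t))%:E).
  apply: (@integrable_bounded_adapted n (invsqrt n) 1 (@adapted_invsqrt n)).
  by move=> x; rewrite gtr0_norm ?invsqrt_gt0 ?invsqrt_le1.
have Ufin n : U n \is a fin_num by exact: integrable_fin_num.
have minv n : measurable_fun setT (fun t => (invsqrt n (traj t))%:E).
  by apply/measurable_EFinP; exact: measurable_adapted (@adapted_invsqrt n).
pose u n := fine (U n).
have u0 n : 0 <= u n.
  by rewrite fine_ge0// integral_ge0// => t _; rewrite lee_fin ltW ?invsqrt_gt0.
have undec : nonincreasing_seq u.
  move=> i j ij; rewrite fine_le//; apply: ge0_le_integral => //.
  - by move=> t _; rewrite lee_fin ltW ?invsqrt_gt0.
  - by move=> t _; rewrite lee_fin invsqrt_nincr.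
have cu : cvgn u by apply: nonincreasing_is_cvgn => //; exists 0 => _ [n _ <-].
have /cvgrPdist_lt /(_ e e0) [m _ mP] := cu.
exists m => n mn; under eq_integral do rewrite EFinB.
rewrite integralB//= -/(U m) -/(U n) -(fineK (Ufin m)) -(fineK (Ufin n)) -EFinB.
rewrite lee_fin -/(u m) -/(u n).
have : limn u <= u n by exact: nonincreasing_cvgn_ge.
have := mP m (leqnn m); rewrite /= distrC ltr_norml => /andP[_].
lra.
Qed.

Lemma increments_cauchy : {ae P, forall t, forall e : R, 0 < e ->
  exists m, forall n, (m <= n)%N -> `|\sum_(m <= k < n) increment (traj t) k| < e}.
Proof.
suff H p : {ae P, forall t, exists m, forall n, (m <= n)%N ->
    `|\sum_(m <= k < n) increment (traj t) k| < p.+1%:R^-1}.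
  have := ae_foralln H; apply: filterS => t Ht e e0.
  have [p pe] : exists p : nat, p.+1%:R^-1 < e.
    exists (Num.bound e^-1); rewrite invf_plt ?posrE//.
    apply: lt_le_trans (archi_boundP _) _; first by rewrite invr_ge0 ltW.
    by rewrite ler_nat.
  by have [m mP] := Ht p; exists m => n /mP /lt_trans; apply.
have p0 : 0 < p.+1%:R^-1 :> R by rewrite invr_gt0.
set e := p.+1%:R^-1 in p0 *.
pose E m n := [set t | ~~ below e m n (traj t)].
have mE m n : measurable (E m n) := @measurable_not_below e m n.
have [K K0 hK] := stopped_energy.
exists (\bigcap_m \bigcup_n E m n); split.
- by apply: bigcapT_measurable => m; exact: bigcupT_measurable.
- apply/eqP; rewrite eq_le measure_ge0 andbT; apply/lee_addgt0Pr => r r0.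
  (* Chosen so that [K c <= r e^2], as Chebyshev's inequality demands; [K + 1] avoids division by
     zero. *)
  rewrite add0e; pose c := r * e ^+ 2 / (K + 1).
  have c0 : 0 < c by rewrite divr_gt0 ?mulr_gt0 ?exprn_gt0//; lra.
  have [m mP] := expected_invsqrt_cauchy c0.
  apply: (@le_trans _ _ (P (\bigcup_n E m n))).
    apply: le_measure; rewrite ?inE; last by move=> t; exact.
      by apply: bigcapT_measurable => i; exact: bigcupT_measurable.
    exact: bigcupT_measurable.
  (* [E m n] grows with [n], so a bound uniform in [n >= m] passes to the union by continuity from
     below. *)
  have Ecvg : P (E m n) @[n --> \oo] --> P (\bigcup_n E m n).
    apply: nondecreasing_cvg_mu => //; first exact: bigcupT_measurable.
    move=> i j ij; apply/subsetPset => t; rewrite /E /=.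
    move=> /forallPn[l lP]; apply/forallPn.
    by exists (widen_ord (ij : i.+1 <= j.+1)%N l).
  rewrite -(cvg_lim _ Ecvg)//; apply: lime_le; first exact: cvgP Ecvg.
  exists m => // n /= mn.
  have e2 : 0 < e ^+ 2 by rewrite exprn_gt0.
  rewrite -(@lee_pmul2l _ (e ^+ 2)%:E)//.
  apply: le_trans (chebyshev_stopped _ _ p0) _; apply: le_trans (hK _ _ _ mn) _.
  under eq_integral do rewrite EFinM.
  rewrite ge0_integralZl//.
  + apply: (@le_trans _ _ (K%:E * c%:E)%E); first by rewrite lee_wpmul2l// mP.
    rewrite -!EFinM lee_fin /c mulrA ler_pdivrMr; last lra.
    rewrite [leLHS]mulrC (mulrC (e ^+ 2)) ler_wpM2l//; last lra.
    by rewrite mulr_ge0 ?ltW.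
  + apply/measurable_EFinP; apply: (measurable_adapted (k := n)
      (G := fun x => invsqrt m x - invsqrt n x)) => x x' xx'.
    rewrite (@adapted_invsqrt n _ _ xx') (@adapted_invsqrt m x x')// => i im.
    by rewrite xx'// (leq_trans im).
  + by move=> t _; rewrite lee_fin subr_ge0 invsqrt_nincr.
- move=> t /= nH m _; apply: contrapT => nE; apply: nH; exists m => n mn.
  rewrite ltNge; apply/negP => en; apply: nE; exists n => //.
  by apply/forallPn; exists ord_max; rewrite /= negb_imply mn -leNgt.
Qed.

(** With [q] the probability of a zero innovation, [n] consecutive zeros have probability [q^n], so
    by [q < 1] an all-zero tail is null. *)
Lemma eps_io : (0 < P [set t | eps 0%N t != 0%N])%E ->
  {ae P, forall t, forall m, exists2 k, (m <= k)%N & eps k t != 0%N}.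
Proof.
move=> eps_pos; apply: ae_foralln => m.
pose q := fine (P (eps 0%N @^-1` [set 0%N])).
have qE : P (eps 0%N @^-1` [set 0%N]) = q%:E by rewrite fineK// fin_num_measure//; exact: measurable_eps.
have q0 : 0 <= q by rewrite fine_ge0.
have q1 : q < 1.
  move: eps_pos; rewrite (_ : [set t | _] = ~` (eps 0%N @^-1` [set 0%N])).
    rewrite probability_setC; last exact: measurable_eps.
    by rewrite [X in (1 - X)%E]qE -EFinB lte_fin subr_gt0.
  by apply/seteqP; split=> t /= /eqP.
have mM : measurable (\bigcap_k (eps (m + k)%N @^-1` [set 0%N])).
  by apply: bigcapT_measurable => k; exact: measurable_eps.
exists (\bigcap_k (eps (m + k)%N @^-1` [set 0%N])); split => //.
- have Pq n : (P (\bigcap_k (eps (m + k)%N @^-1` [set 0%N])) <= (q ^+ n)%:E)%E.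
    pose s : seq inar_idx := [seq Some (inl (m + k)%N) | k <- iota 0 n].
    have us : uniq s.
      by rewrite map_inj_uniq ?iota_uniq// => i j [] /addnI.
    have := indepZ (fun=> [set 0%N]) us.
    have -> : (\prod_(i <- s) P (Z i @^-1` [set 0%N]) = (q ^+ n)%:E)%E.
      rewrite big_map /= -[in RHS](size_iota 0 n).
      elim: (iota 0 n) => [|k l IH]; first by rewrite big_nil.
      by rewrite big_cons IH /= eps_law qE exprS EFinM.
    move=> <-; apply: le_measure; rewrite ?inE//.
      apply: fin_bigcap_measurable => [|i _]; [exact: finite_seq|exact: rvZ].
    by move=> t tm i /= /mapP[k _ ->]; exact: tm.
  have PE : P (\bigcap_k (eps (m + k)%N @^-1` [set 0%N])) \is a fin_num.
    by rewrite fin_num_measure.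
  have PE0 : (0 <= P (\bigcap_k (eps (m + k)%N @^-1` [set 0%N])))%E by [].
  suff : (P (\bigcap_k (eps (m + k)%N @^-1` [set 0%N])) <= 0)%E.
    by move=> PE1; apply/eqP; rewrite eq_le PE0 PE1.
  rewrite -(fineK PE) lee_fin.
  have qn0 : q ^+ n @[n --> \oo] --> (0 : R) by apply: cvg_expr; rewrite ger0_norm.
  apply: (cvgr_to_ge qn0); near=> n.
  by rewrite -lee_fin fineK.
- move=> t /= nt k _; apply: contrapT => /= ek; apply: nt.
  by exists (m + k)%N; [exact: leq_addr|exact/eqP].
Unshelve. all: by end_near. Qed.

Lemma inarX_io t : (forall m, exists2 k, (m <= k)%N & eps k t != 0%N) ->
  forall m, exists2 k, (m <= k)%N & traj t k != 0%N.
Proof.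
move=> eio m; have [k mk ek] := eio m; exists k.+1; first exact: leqW.
by rewrite /traj /= addn_eq0 negb_and ek orbT.
Qed.

End inar.

(** * Almost sure consistency of the estimators *)

Theorem theorem3p4p1 (d : measure_display) (T : measurableType d) (R : realType)
  (P : probability T R) (alpha : R) (X0 : T -> nat) (eps : nat -> T -> nat)
  (xi : nat -> nat -> T -> nat) (mu_eps : R) (s1 s2 th1 th2 : nat) :
  0 < alpha < 1 ->
  nat_rvs (inar_family X0 eps xi) ->
  mutually_independent P (inar_family X0 eps xi) ->
  (forall k (B : set nat), P (eps k @^-1` B) = P (eps 0%N @^-1` B)) ->
  (forall k j, P (xi k j @^-1` [set 1%N]) = alpha%:E
               /\ P (xi k j @^-1` [set 0%N]) = (1 - alpha)%:E) ->
  (\int[P]_t ((eps 0%N t ^ 2)%:R : R)%:E < +oo)%E ->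
  (0 < P [set t | eps 0%N t != 0%N])%E ->
  (\int[P]_t ((eps 0%N t)%:R : R)%:E = mu_eps%:E)%E ->
  (\int[P]_t ((X0 t ^ 2)%:R : R)%:E < +oo)%E ->
  (0 < s1)%N -> (s1.+1 < s2)%N -> (0 < th1)%N -> (0 < th2)%N ->
  {ae P, forall t,
    let Y := inarY X0 eps xi s1 s2 th1 th2 t : nat -> R in
    exists n0 : nat, (s2.+1 <= n0)%N /\
      (forall n, (n0 <= n)%N -> unique_argmin3 (Qn mu_eps s1 s2 n Y)) /\
      (forall a b c : nat -> R,
         (forall n, (n0 <= n)%N -> is_argmin3 (Qn mu_eps s1 s2 n Y) (a n) (b n) (c n)) ->
         a n @[n --> \oo] --> alpha /\
         b n @[n --> \oo] --> Y s1 - alpha / (1 + alpha ^+ 2) * (Y s1.-1 + Y s1.+1)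
                                - (1 - alpha) / (1 + alpha ^+ 2) * mu_eps /\
         c n @[n --> \oo] --> Y s2 - alpha / (1 + alpha ^+ 2) * (Y s2.-1 + Y s2.+1)
                                - (1 - alpha) / (1 + alpha ^+ 2) * mu_eps)}.
Proof.
move=> alpha01 rvZ indepZ eps_law xi_law eps2 eps_pos eps_mean _ s1_gt0 s12 _ _.
have cauchy := increments_cauchy alpha01 rvZ indepZ eps_law xi_law eps2 eps_mean.
have io := eps_io rvZ indepZ eps_law eps_pos.
(* From here on a single path is fixed; the limits in the goal are [outlier_estimate] at [alpha],
   unfolded. *)
apply: filterS2 cauchy io => t cauchy /inarX_io io.
pose Y := inarY X0 eps xi s1 s2 th1 th2 t : nat -> R.
have YE k : k != s1 -> k != s2 -> Y k = (traj X0 eps xi t k)%:R.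
  by move=> /negbTE ks1 /negbTE ks2; rewrite /Y /inarY ks1 ks2 !addr0.
have Aoo := sqsum_cvgy (R := R) (io X0 xi).
apply: (@least_squares_consistent R mu_eps s1 s2 Y alpha).
  exact: sumYY_cvgy s12 YE Aoo.
exact: sumYY1_sumYY_cvg s12 YE Aoo cauchy.
Qed.
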